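(* For any $\mathscr{B}\subseteq\mathbb{N}$ such that $\eta^*$ is a regular Toeplitz sequence, we have $\mathcal{P}(X_\eta)=\mathcal{P}(X_{\eta'})$.
   Context: $\mathbb{N}=\{1,2,\dots\}$. For $\mathscr{A}\subseteq\mathbb{N}$: $\mathcal{M}_{\mathscr{A}}=\bigcup_{a\in\mathscr{A}}a\mathbb{Z}$, $\mathcal{F}_{\mathscr{A}}=\mathbb{Z}\setminus\mathcal{M}_{\mathscr{A}}$, and $\mathscr{A}^{prim}$ is the set of those $a\in\mathscr{A}$ not divisible by any other element of $\mathscr{A}$. The logarithmic density $\boldsymbol{\delta}(\mathcal{M}_{\mathscr{A}})=\lim_{L\to\infty}\frac1{\ln L}\sum_{\ell\in\mathcal{M}_{\mathscr{A}}\cap[1,L]}\frac1\ell$ always exists (Davenport–Erdős). $\mathscr{A}$ is Behrend if $\boldsymbol{\delta}(\mathcal{M}_{\mathscr{A}})=1$. $\mathscr{B}'=(\mathscr{B}\cup C)^{prim}$, where $C=\{c\in\mathbb{N}:c\mathcal{A}\subseteq\mathscr{B}\text{ for some Behrend set }\mathcal{A}\}$ (the tautification of $\mathscr{B}$). $\mathscr{B}^*=(\mathscr{B}\cup D)^{prim}$, where $D=\{d\in\mathbb{N}: d\mathcal{A}\subseteq\mathscr{B}\text{ for some infinite pairwise coprime set }\mathcal{A}\subseteq\mathbb{N}\}$. Put $\eta=\mathbf{1}_{\mathcal{F}_{\mathscr{B}}}$, $\eta'=\mathbf{1}_{\mathcal{F}_{\mathscr{B}'}}$, $\eta^*=\mathbf{1}_{\mathcal{F}_{\mathscr{B}^*}}$,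 all in $\{0,1\}^{\mathbb{Z}}$. Let $\sigma$ be the left shift on $\{0,1\}^{\mathbb{Z}}$; for $x\in\{0,1\}^{\mathbb{Z}}$, $X_x$ is the closure of $\{\sigma^kx:k\in\mathbb{Z}\}$. For a closed $\sigma$-invariant $X\subseteq\{0,1\}^{\mathbb{Z}}$, $\mathcal{P}(X)$ is the set of $\sigma$-invariant Borel probability measures on $X$ (viewed as measures on $\{0,1\}^{\mathbb{Z}}$). A sequence $x\in\{0,1\}^{\mathbb{Z}}$ is Toeplitz if for each $i\in\mathbb{Z}$ there is $s\in\mathbb{N}$ with $x(i+sk)=x(i)$ for all $k\in\mathbb{Z}$. Let $\mathrm{Per}(x,s)=\{i\in\mathbb{Z}: x(i+sk)=x(i)\text{ for all }k\in\mathbb{Z}\}$. A Toeplitz sequence $x$ is regular if $\lim_{r\to\infty}d\big(\bigcup_{s\le r}\mathrm{Per}(x,s)\big)=1$, where $d(A)=\lim_{L\to\infty}\frac1L|A\cap[1,L]|$. (The sequence $\eta^*$ is always Toeplitz.) *)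

(* Defs.v *)
From HB Require Import structures.
From mathcomp Require Import all_boot all_order all_algebra.
From mathcomp Require Import all_classical all_reals all_analysis.
Set Implicit Arguments.
Unset Strict Implicit.
Unset Printing Implicit Defensive.
Import Order.TTheory GRing.Theory Num.Theory.
Import numFieldNormedType.Exports.
Local Open Scope classical_set_scope.
Local Open Scope ring_scope.

(* Subsets of N = {1, 2, ...} are subsets of [nat] included in [posn]. *)
Definition posn : set nat := [set n | (0 < n)%N].

Definition multiples (A : set nat) : set int :=
  [set z | exists2 a : nat, A a & (a%:Z %| z)%Z].

Definition free (A : set nat) : set int := ~` multiples A.

Definition primitive_part (A : set nat) : set nat :=
  [set a | A a /\ forall b, A b -> (b %| a)%N -> b = a].

(* Partial means whose limit is the logarithmic density of [M]; the values at
   [L <= 1], where [ln L = 0], are irrelevant to the limit. *)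
Definition log_mean (R : realType) (M : set int) (L : nat) : R :=
  (ln (L%:R : R))^-1 * \sum_(1 <= l < L.+1 | (l%:Z : int) \in M) (l%:R : R)^-1.

Definition behrend (R : realType) (A : set nat) : Prop :=
  A `<=` posn /\ (log_mean R (multiples A) L @[L --> \oo] --> (1 : R)).

Definition tautification (R : realType) (B : set nat) : set nat :=
  primitive_part (B `|` [set c | posn c /\
    exists2 A : set nat, behrend R A & (muln c) @` A `<=` B]).

Definition pairwise_coprime (A : set nat) : Prop :=
  forall a b, A a -> A b -> a <> b -> coprime a b.

Definition star (B : set nat) : set nat :=
  primitive_part (B `|` [set d | posn d /\
    exists A : set nat, [/\ A `<=` posn, infinite_set A, pairwise_coprime A
                          & (muln d) @` A `<=` B]]).

(* [{0, 1}^Z] with the product of the discrete topologies. *)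
Definition biseq : Type := prod_topology (fun _ : int => bool).
HB.instance Definition _ := Pointed.on biseq.
HB.instance Definition _ := Nbhs.on biseq.
HB.instance Definition _ := Topological.on biseq.
HB.instance Definition _ := Uniform.on biseq.

Definition indic_seq (F : set int) : biseq := fun i => i \in F.

Definition eta (B : set nat) : biseq := indic_seq (free B).

(* [shift_by k] is the [k]-th power, [k] in [Z], of the left shift. *)
Definition shift_by (k : int) (x : biseq) : biseq := fun i => x (i + k).
Definition left_shift : biseq -> biseq := shift_by 1.

Definition orbit_closure (x : biseq) : set biseq :=
  closure [set shift_by k x | k in [set: int]].

Definition borel_biseq := g_sigma_algebraType (@open biseq).

(* Measures on the subshift [X] are seen as measures on the full shift that
   give mass 1 to [X]; [X] is meant to be closed, hence Borel. *)
Definition invariant_measures (R : realType) (X : set biseq) :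
    set (probability borel_biseq R) :=
  [set mu | mu X = 1%E /\
    forall A : set borel_biseq, measurable A -> mu (left_shift @^-1` A) = mu A].

Arguments invariant_measures : clear implicits.

Definition per (x : biseq) (s : nat) : set int :=
  [set i | forall k : int, x (i + s%:Z * k) = x i].

Definition toeplitz (x : biseq) : Prop :=
  forall i : int, exists2 s : nat, (0 < s)%N & per x s i.

(* [lim] is total; the only use below is on finite unions of sets [per x s]
   with [0 < s], which are periodic, so that the limit exists. *)
Definition density (R : realType) (A : set int) : R :=
  limn (fun L : nat => (\sum_(1 <= l < L.+1) ((l%:Z : int) \in A))%:R / L%:R : R).

Definition regular_toeplitz (R : realType) (x : biseq) : Prop :=
  toeplitz x /\
  (density R (\bigcup_(s in [set s | (0 < s <= r)%N]) per x s) @[r --> \oo]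
     --> (1 : R)).

(* Main.v *)
Require Import Defs.
From mathcomp Require Import all_boot all_order all_algebra.
From mathcomp Require Import all_classical all_reals all_analysis.
From mathcomp Require Import measurable_realfun.
From mathcomp Require Import zify ring lra.
Set Implicit Arguments.
Unset Strict Implicit.
Unset Printing Implicit Defensive.
Import Order.TTheory GRing.Theory Num.Theory.
Import numFieldNormedType.Exports.
Local Open Scope classical_set_scope.
Local Open Scope ring_scope.

(** Write [B1] for [B] together with the cofactors [c] of Behrend sets, and [D] for
[B] together with the cofactors [d] of infinite pairwise coprime sets. Passing to
primitive parts does not change multiples, so the sequences attached to [B], to
its tautification and to [star B] are the indicators of the integers without
divisor in [B], in [B1] and in [D]; the inclusions [B `<=` B1 `<=` D] order them.
What is shown ([invariant_measures_between]) is that any two sequences [x] and [y]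
between the second and the first have orbit closures with the same invariant
measures.

An invariant measure on the orbit closure of [x] that charges a pattern [w]
forces [w] to occur in [x] with positive frequency in some window of every length
([cylinder_frequency]). So it is enough that such a frequent pattern occurs in [y]
as well, with its ones at integers without divisor in [B1] and its zeros at
multiples of elements of [B] ([frequent_pattern]).

Sets of multiples are measured by [sieve_limit A], the infimum over [M] of the
density of the integers free of those elements of [A] that divide [M]. This is
the Haar measure, in the profinite integers, of the elements without divisor in
[A]. Three facts make it work. By the correlation inequality [harris], the
logarithmic sums over the integers without divisor in [A] are at least
[sieve_limit A] times the full harmonic sum ([harmonic_sum_sifted_ge]): this is
the hard half of the theorem of Davenport and Erdos. Hence Behrend sets have
sieve limit 0, and [B] and [B1] have the same sieve limit ([sieve_limit_setU]).

Given the frequent pattern, choose a modulus [N] such that the sieve by the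
divisors of [N] nearly reaches its limit and such that, by regularity, almost all
residues modulo [N] determine the value of [eta (star B)]. The occurrences of [w]
whose positions are all determined fill residue classes of positive density, and
by the equality of the sieve limits one class [r] keeps a positive density of
integers [z] such that [z + s] has no divisor in [B1] for the ones [s] of [w], up
to any finite level of the sieve ([residue_pigeonhole]). A zero [s] of [w] sits at
a determined zero of [eta (star B)], so some [e] in [D] divides both [N] and
[r + s] ([sifted_residue_class]); it can be turned into a multiple of [B] by
prescribing one more congruence modulo an element of an infinite coprime set,
whose prime factors are large and new ([forces_zeros_exists]). These congruences
keep the ones away from those primes, and the other primes are independent of
them, so that a comparison of logarithmic sums yields an actual integer where the
ones survive all of [B1] ([sifted_pattern_exists]). *)

(** * Positive correlation of divisor-closed conditions *)

Definition div_antitone (R : realFieldType) (f : nat -> R) : Prop :=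
  forall d n : nat, (0 < n)%N -> (d %| n)%N -> f n <= f d.

(** [M] times the expectation of [f (gcd x M)] for [x] uniform modulo [M]. *)
Definition gcd_sum (R : realFieldType) (f : nat -> R) (M : nat) : R :=
  \sum_(x < M) f (gcdn x M).

Lemma sum_chinese (R : realFieldType) (M1 M2 : nat) (h : nat -> nat -> R) :
  coprime M1 M2 -> (0 < M1)%N -> (0 < M2)%N ->
  \sum_(z < M1 * M2) h (z %% M1)%N (z %% M2)%N =
  \sum_(x < M1) \sum_(y < M2) h x y.
Proof.
move=> co M1_gt0 M2_gt0; rewrite pair_big_dep /=.
have ltM (p : 'I_M1 * 'I_M2) : (chinese M1 M2 p.1 p.2 %% (M1 * M2) < M1 * M2)%N.
  by rewrite ltn_mod muln_gt0 M1_gt0.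
rewrite (reindex (fun p : 'I_M1 * 'I_M2 => Ordinal (ltM p))) /=; last first.
  exists (fun z : 'I_(M1 * M2) =>
    (Ordinal (ltn_pmod z M1_gt0), Ordinal (ltn_pmod z M2_gt0))).
    move=> [x y] _ /=; congr pair; apply/val_inj => /=.
      by rewrite modn_dvdm ?dvdn_mulr// chinese_modl// modn_small.
    by rewrite modn_dvdm ?dvdn_mull// chinese_modr// modn_small.
  move=> z _; apply/val_inj => /=.
  by rewrite -chinese_mod// modn_small.
apply: eq_bigr => -[x y] _ /=; congr h.
  by rewrite modn_dvdm ?dvdn_mulr// chinese_modl// modn_small.
by rewrite modn_dvdm ?dvdn_mull// chinese_modr// modn_small.
Qed.

Lemma gcdn_coprime_mul (z M1 M2 : nat) : coprime M1 M2 ->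
  gcdn z (M1 * M2) = (gcdn z M1 * gcdn z M2)%N.
Proof.
move=> co; apply/eqP; rewrite eqn_dvd; apply/andP; split; last first.
  rewrite Gauss_dvd; last first.
    apply: coprime_dvdl (dvdn_gcdr _ _) _.
    exact: coprime_dvdr (dvdn_gcdr _ _) co.
  rewrite !dvdn_gcd !dvdn_gcdl /=.
  by rewrite (dvdn_mulr _ (dvdn_gcdr _ _)) (dvdn_mull _ (dvdn_gcdr _ _)).
rewrite muln_gcdl !muln_gcdr !dvdn_gcd dvdn_gcdr.
by rewrite !(dvdn_mulr _ (dvdn_gcdl _ _)) (dvdn_mull _ (dvdn_gcdl _ _)).
Qed.

Lemma gcd_sum_coprime (R : realFieldType) (f : nat -> R) (M1 M2 : nat) :
  coprime M1 M2 -> (0 < M1)%N -> (0 < M2)%N ->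
  gcd_sum f (M1 * M2) =
  \sum_(x < M1) gcd_sum (fun d => f (gcdn x M1 * d)%N) M2.
Proof.
move=> co M1_gt0 M2_gt0.
rewrite /gcd_sum -(sum_chinese (fun x y => f (gcdn x M1 * gcdn y M2)%N))//.
by apply: eq_bigr => z _; rewrite gcdn_coprime_mul// !gcdn_modl.
Qed.

(** The double sum of [(a i - a j) * (b i - b j)] is nonnegative, and it is twice
    the difference of the two sides. *)
Lemma chebyshev_sum (R : realFieldType) (n : nat) (a b : 'I_n -> R) :
  (forall i j, 0 <= (a i - a j) * (b i - b j)) ->
  (\sum_i a i) * (\sum_i b i) <= n%:R * \sum_i a i * b i.
Proof.
move=> ab; have : 0 <= \sum_i \sum_j (a i - a j) * (b i - b j).
  by apply: sumr_ge0 => i _; apply: sumr_ge0.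
have -> : \sum_i \sum_j (a i - a j) * (b i - b j) =
    (n%:R * \sum_i a i * b i - (\sum_i a i) * (\sum_i b i)) *+ 2.
  under eq_bigr => i _.
    have -> : \sum_j (a i - a j) * (b i - b j) =
        n%:R * (a i * b i) - a i * (\sum_j b j) - b i * (\sum_j a j)
        + \sum_j a j * b j.
      rewrite (eq_bigr (fun j => a i * b i - a i * b j - b i * a j + a j * b j)).
        by rewrite big_split/= !sumrB sumr_const card_ord -!mulr_sumr mulr_natl.
      by move=> j _; ring.
    over.
  rewrite big_split/= !sumrB sumr_const card_ord -!mulr_suml -mulr_sumr.
  by rewrite -mulr_natl; ring.
by rewrite pmulrn_lge0// subr_ge0.
Qed.

Lemma gcd_sum_antitone (R : realFieldType) (f : nat -> R) (M : nat) :
  (0 < M)%N -> div_antitone f ->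
  div_antitone (fun d => gcd_sum (fun e => f (d * e)%N) M).
Proof.
move=> M_gt0 fP d n n_gt0 dn; apply: ler_sum => x _; apply: fP.
  by rewrite muln_gt0 n_gt0 gcdn_gt0 M_gt0 orbT.
exact: dvdn_mul.
Qed.

Lemma div_antitone_scale (R : realFieldType) (f : nat -> R) (d : nat) :
  (0 < d)%N -> div_antitone f -> div_antitone (fun e => f (d * e)%N).
Proof.
move=> d_gt0 fP e n n_gt0 en.
by apply: fP; rewrite ?muln_gt0 ?d_gt0// dvdn_mul.
Qed.

(** Harris' inequality: antitone functions of [gcd x M] are positively correlated. *)
Definition harris_at (R : realFieldType) (M : nat) : Prop :=
  forall f g : nat -> R, div_antitone f -> div_antitone g ->
  gcd_sum f M * gcd_sum g M <= M%:R * gcd_sum (fun d => f d * g d) M.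

(** The divisors of a prime power form a chain, along which both functions are
    antitone: the case of Chebyshev's sum inequality. *)
Lemma harris_prime_power (R : realFieldType) (p e : nat) :
  prime p -> harris_at R (p ^ e).
Proof.
move=> p_prime f g fP gP; apply: chebyshev_sum => i j.
have pe_gt0 : (0 < p ^ e)%N by rewrite expn_gt0 prime_gt0.
have g_gt0 (k : nat) : (0 < gcdn k (p ^ e))%N by rewrite gcdn_gt0 pe_gt0 orbT.
have [u _ iE] : exists2 u, (u <= e)%N & gcdn i (p ^ e) = (p ^ u)%N.
  by apply/(dvdn_pfactor _ _ p_prime); exact: dvdn_gcdr.
have [v _ jE] : exists2 v, (v <= e)%N & gcdn j (p ^ e) = (p ^ v)%N.
  by apply/(dvdn_pfactor _ _ p_prime); exact: dvdn_gcdr.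
have := g_gt0 i; have := g_gt0 j; rewrite iE jE => pv_gt0 pu_gt0.
have [uv|/ltnW vu] := leqP u v.
  have uvd : (p ^ u %| p ^ v)%N by rewrite dvdn_exp2l.
  by apply: mulr_ge0; rewrite subr_ge0; [apply: fP|apply: gP].
have vud : (p ^ v %| p ^ u)%N by rewrite dvdn_exp2l.
by apply: mulr_le0; rewrite subr_le0; [apply: fP|apply: gP].
Qed.

(** The residues modulo [M1] and [M2] are independent: first condition on the
    residue modulo [M1] and use the inequality modulo [M2], then use it modulo
    [M1] for the conditional expectations, which are antitone again. *)
Lemma harris_coprime_mul (R : realFieldType) (M1 M2 : nat) :
  coprime M1 M2 -> (0 < M1)%N -> (0 < M2)%N ->
  harris_at R M1 -> harris_at R M2 -> harris_at R (M1 * M2).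
Proof.
move=> co M1_gt0 M2_gt0 H1 H2 f g fP gP.
rewrite !gcd_sum_coprime//.
pose F d := gcd_sum (fun e => f (d * e)%N) M2.
pose G d := gcd_sum (fun e => g (d * e)%N) M2.
have /le_trans -> // := H1 F G (gcd_sum_antitone M2_gt0 fP)
  (gcd_sum_antitone M2_gt0 gP).
rewrite natrM -mulrA ler_wpM2l// mulr_sumr; apply: ler_sum => x _.
have x_gt0 : (0 < gcdn x M1)%N by rewrite gcdn_gt0 M1_gt0 orbT.
by apply: H2; exact: div_antitone_scale.
Qed.

Lemma harris (R : realFieldType) (M : nat) : (0 < M)%N -> harris_at R M.
Proof.
have [n] := ubnP M; elim: n M => // n IHn M.
rewrite ltnS => Mn M_gt0.
have [M_le1|M_gt1] := leqP M 1.
  have -> : M = 1%N by apply/eqP; rewrite eqn_leq M_le1.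
  by rewrite -(expn0 2); exact: harris_prime_power.
have p_prime : prime (pdiv M) by rewrite pdiv_prime.
have [m pm ME] := pfactor_coprime p_prime M_gt0.
have m_gt0 : (0 < m)%N.
  by move: M_gt0; rewrite {1}ME muln_gt0 => /andP[].
have e_gt0 : (0 < logn (pdiv M) M)%N.
  by rewrite logn_gt0 mem_primes p_prime M_gt0 pdiv_dvd.
rewrite ME; apply: harris_coprime_mul => //.
- by rewrite coprime_sym coprimeXl.
- apply: IHn => //; apply: leq_trans Mn.
  rewrite [in X in (_ < X)%N]ME ltn_Pmulr// -{1}(expn0 (pdiv M)).
  by rewrite ltn_exp2l ?prime_gt1.
- exact: harris_prime_power.
Qed.

(** * Counting in windows and periodic sets *)

Definition window_count (P : int -> bool) (k : int) (L : nat) : nat :=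
  (\sum_(j < L) P (k + j%:Z)%R)%N.

Definition periodic (P : int -> bool) (N : nat) : Prop :=
  forall z : int, P (z + N%:Z) = P z.

Lemma periodic_mulz (P : int -> bool) (N : nat) (k z : int) :
  periodic P N -> P (z + k * N%:Z) = P z.
Proof.
move=> PN; elim/int_ind: k => [|k IH|k IH].
- by rewrite mul0r addr0.
- by rewrite -addn1 PoszD mulrDl mul1r addrA PN.
- by rewrite -PN -IH; congr P; rewrite -addn1 PoszD; ring.
Qed.

Lemma periodic_congr (P : int -> bool) (N : nat) (z w : int) :
  periodic P N -> (N%:Z %| z - w)%Z -> P z = P w.
Proof.
by move=> PN /dvdzP[q zw]; rewrite -(periodic_mulz q w PN) -zw; congr P; ring.
Qed.

Lemma periodic_dvdn (P : int -> bool) (N M : nat) :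
  (N %| M)%N -> periodic P N -> periodic P M.
Proof.
by move=> /dvdnP[q ->] PN z; rewrite PoszM; exact: periodic_mulz.
Qed.

Lemma periodic_add (P : int -> bool) (N : nat) (s : int) :
  periodic P N -> periodic (fun z => P (z + s)) N.
Proof. by move=> PN z; rewrite addrAC PN. Qed.

Lemma periodicI (P Q : int -> bool) (N : nat) :
  periodic P N -> periodic Q N -> periodic (fun z => P z && Q z) N.
Proof. by move=> PN QN z; rewrite PN QN. Qed.

Lemma periodicC (P : int -> bool) (N : nat) :
  periodic P N -> periodic (fun z => ~~ P z) N.
Proof. by move=> PN z; rewrite PN. Qed.

Lemma periodic_residue (N : nat) (r : int) :
  periodic (fun z => (N%:Z %| z - r)%Z) N.
Proof. by move=> z; rewrite addrAC rpredDr ?dvdzz. Qed.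

Lemma window_count_cat (P : int -> bool) (k : int) (L1 L2 : nat) :
  window_count P k (L1 + L2) =
  (window_count P k L1 + window_count P (k + L1%:Z) L2)%N.
Proof.
rewrite /window_count big_split_ord/=; congr addn.
by apply: eq_bigr => j _; rewrite PoszD addrA.
Qed.

Lemma window_count_sub (P Q : int -> bool) (k : int) (L : nat) :
  (forall z, P z -> Q z) -> (window_count P k L <= window_count Q k L)%N.
Proof.
move=> PQ; apply: leq_sum => j _.
by case: (P _) (PQ (k + j%:Z)) => // ->.
Qed.

Lemma eq_window_count (P Q : int -> bool) (k : int) (L : nat) :
  P =1 Q -> window_count P k L = window_count Q k L.
Proof. by move=> PQ; apply: eq_bigr => j _; rewrite PQ. Qed.

Lemma window_count_le (P : int -> bool) (k : int) (L : nat) :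
  (window_count P k L <= L)%N.
Proof.
rewrite -[leqRHS]card_ord -sum1_card; apply: leq_sum => j _.
by case: (P _).
Qed.

Lemma window_count_add (P : int -> bool) (s k : int) (L : nat) :
  window_count (fun z => P (z + s)) k L = window_count P (k + s) L.
Proof. by apply: eq_bigr => j _; rewrite addrAC. Qed.

Lemma window_countC (P : int -> bool) (k : int) (L : nat) :
  (window_count P k L + window_count (fun z => ~~ P z) k L = L)%N.
Proof.
rewrite -big_split/= -[RHS]card_ord -sum1_card.
by apply: eq_bigr => j _; case: (P _).
Qed.

Lemma window_count_split (P Q : int -> bool) (k : int) (L : nat) :
  window_count P k L = (window_count (fun z => P z && Q z) k L +
                        window_count (fun z => P z && ~~ Q z) k L)%N.
Proof.
rewrite -big_split/=; apply: eq_bigr => j _.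
by case: (P _); case: (Q _).
Qed.

Lemma window_count_union (m : nat) (P : int -> bool) (Q : 'I_m -> int -> bool)
    (k : int) (L : nat) : (forall z, P z -> exists s, Q s z) ->
  (window_count P k L <= \sum_(s < m) window_count (Q s) k L)%N.
Proof.
move=> PQ; rewrite exchange_big/=; apply: leq_sum => j _.
case: (boolP (P _)) => // /PQ[s Qs].
by rewrite (bigD1 s)//= Qs leq_addr.
Qed.

(** Moving a window of one period by 1 drops [P k] and gains [P (k + N)], which
    are equal. *)
Lemma window_count_period (P : int -> bool) (N : nat) (k : int) :
  periodic P N -> window_count P k N = window_count P 0 N.
Proof.
move=> PN; have step (i : int) : window_count P (i + 1) N = window_count P i N.
  have w1 (l : int) : window_count P l 1 = P l.
    by rewrite /window_count big_ord1 addr0.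
  apply/eqP; rewrite -(eqn_add2l (P i)) -{1}(w1 i) -(window_count_cat P i 1 N).
  by rewrite -(PN i) -w1 [eqbRHS]addnC -window_count_cat addnC.
elim/int_ind: k => // k IH; first by rewrite -IH -addn1 PoszD step.
by rewrite -IH -step; congr window_count; rewrite -addn1 PoszD; ring.
Qed.

Lemma window_count_periods (P : int -> bool) (N q : nat) (k : int) :
  periodic P N -> window_count P k (q * N) = (q * window_count P 0 N)%N.
Proof.
move=> PN; elim: q k => [|q IH] k.
  by rewrite !mul0n /window_count big_ord0.
by rewrite !mulSn window_count_cat IH window_count_period.
Qed.

(** * Logarithmic sums of periodic sets *)

Definition harmonic_sum (R : realType) (P : int -> bool) (L : nat) : R :=
  \sum_(1 <= l < L.+1 | P l%:Z) (l%:R)^-1.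

Section HarmonicSum.
Context {R : realType}.
Implicit Types (P Q : int -> bool) (L N : nat).
Notation hsum := (harmonic_sum R).

Lemma harmonic_sum_mkcond P L :
  hsum P L = \sum_(1 <= l < L.+1) (P l%:Z)%:R * (l%:R)^-1.
Proof.
rewrite /harmonic_sum big_mkcond/=; apply: eq_bigr => l _.
by case: ifP => _; rewrite ?mul1r ?mul0r.
Qed.

Lemma harmonic_sum_recr P L :
  hsum P L.+1 = hsum P L + (P L.+1%:Z)%:R * (L.+1%:R)^-1.
Proof. by rewrite !harmonic_sum_mkcond big_nat_recr. Qed.

Lemma harmonic_sum_ge0 P L : 0 <= hsum P L.
Proof. by apply: sumr_ge0 => l _; rewrite invr_ge0. Qed.

Lemma harmonic_sum_split P Q L :
  hsum P L = hsum (fun z => P z && Q z) L + hsum (fun z => P z && ~~ Q z) L.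
Proof.
rewrite !harmonic_sum_mkcond -big_split/=; apply: eq_bigr => l _.
by rewrite -mulrDl -natrD; case: (P _); case: (Q _).
Qed.

Lemma harmonic_sumC P L : hsum P L + hsum (fun z => ~~ P z) L = hsum predT L.
Proof. by rewrite (harmonic_sum_split predT P). Qed.

Lemma harmonic_sum_le_length P L : hsum P L <= L%:R.
Proof.
elim: L => [|L IH]; first by rewrite /harmonic_sum big_nil.
rewrite harmonic_sum_recr -[leRHS]natr1 lerD//.
rewrite mulr_ile1 ?invr_ge0 ?invf_le1 ?ler1n ?ltr0n//.
by case: (P _).
Qed.

Lemma harmonic_sum_homo P L L' : (L <= L')%N -> hsum P L <= hsum P L'.
Proof.
elim: L' => [|L' IH]; first by rewrite leqn0 => /eqP ->.
rewrite leq_eqVlt => /predU1P[-> //|/IH /le_trans]; apply.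
by rewrite harmonic_sum_recr lerDl mulr_ge0 ?invr_ge0.
Qed.

Lemma harmonic_sum_add P (i L : nat) :
  hsum (fun z => P (z - i%:Z)) (i + L)%N <= i%:R + hsum P L.
Proof.
elim: L => [|L IH].
  rewrite addn0; apply: le_trans (harmonic_sum_le_length _ _) _.
  by rewrite lerDl harmonic_sum_ge0.
rewrite addnS !harmonic_sum_recr addrA lerD//.
rewrite -addnS PoszD addrAC subrr add0r; apply: ler_wpM2l => //.
by rewrite lef_pV2 ?ler_nat ?leq_addl// posrE ltr0n ?addnS.
Qed.

Lemma harmonic_sum_shift P (i L : nat) :
  hsum (fun z => P (z - i%:Z)) L <= i%:R + hsum P L.
Proof.
apply: le_trans (harmonic_sum_add P i L).
exact/harmonic_sum_homo/leq_addl.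
Qed.

(** Each term 1/l of a block of length [N] is at most the inverse of the start of
    the block, which is at most every term of the preceding block. *)
Lemma harmonic_sum_block P N q : periodic P N -> (0 < q)%N -> (0 < N)%N ->
  hsum P (q.+1 * N)%N - hsum P (q * N)%N <=
  (window_count P 0 N)%:R / N%:R *
  (hsum predT (q * N)%N - hsum predT (q.-1 * N)%N).
Proof.
move=> PN q_gt0 N_gt0.
have diff Q a b : hsum Q (a + b)%N - hsum Q a =
    \sum_(j < b) (Q (a + j).+1%:Z)%:R * ((a + j).+1%:R)^-1.
  elim: b => [|b IH]; first by rewrite addn0 subrr big_ord0.
  by rewrite big_ord_recr/= -IH addnS harmonic_sum_recr; ring.
rewrite mulSnr diff; case: q q_gt0 => // q _.
rewrite mulSnr [_.+1.-1]/= diff.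
rewrite -mulSnr.
have D0 : (0 : R) < (q.+1 * N)%N%:R by rewrite ltr0n muln_gt0 N_gt0.
apply: (@le_trans _ _ ((window_count P 0 N)%:R / (q.+1 * N)%N%:R)).
  rewrite -(window_count_period (q.+1 * N)%N.+1%:Z PN) /window_count natr_sum.
  rewrite mulr_suml; apply: ler_sum => j _; rewrite -addSn PoszD.
  apply: ler_wpM2l => //; rewrite lef_pV2 ?posrE ?ltr0n ?muln_gt0 ?N_gt0// ler_nat.
  by rewrite addSn ltnW// ltnS leq_addr.
rewrite -mulrA ler_wpM2l// -ler_pdivrMl ?invr_gt0 ?ltr0n// invrK.
rewrite -[N in N%:R * _]card_ord mulr_natl -sumr_const; apply: ler_sum => j _.
rewrite mul1r lef_pV2 ?posrE ?ltr0n ?muln_gt0 ?N_gt0// ler_nat mulSnr -addnS leq_add2l.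
exact: ltn_ord.
Qed.

(** Up to the first block, the sum over each block is bounded by the share of [P]
    in a period times the full sum over the preceding block. *)
Lemma harmonic_sum_periodic_le P N L : periodic P N -> (0 < N)%N ->
  hsum P L <= (window_count P 0 N)%:R / N%:R * hsum predT L + N%:R.
Proof.
move=> PN N_gt0.
have main q : hsum P (q.+1 * N)%N <=
    (window_count P 0 N)%:R / N%:R * hsum predT (q * N)%N + N%:R.
  elim: q => [|q IH].
    rewrite mul1n mul0n; apply: le_trans (harmonic_sum_le_length _ _) _.
    by rewrite lerDr mulr_ge0 ?divr_ge0 ?harmonic_sum_ge0.
  have := harmonic_sum_block PN (ltn0Sn q) N_gt0; rewrite mulrBr [_.+1.-1]/=.
  by move: IH; lra.
apply: le_trans (harmonic_sum_homo P _) _; last first.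
  apply: le_trans (main (L %/ N)%N) _; rewrite lerD2r ler_wpM2l ?divr_ge0//.
  exact/harmonic_sum_homo/leq_trunc_div.
by rewrite mulSnr ltnW// {1}(divn_eq L N) ltn_add2l ltn_pmod.
Qed.

Lemma harmonic_sum_periodic_ge P N L : periodic P N -> (0 < N)%N ->
  (window_count P 0 N)%:R / N%:R * hsum predT L - N%:R <= hsum P L.
Proof.
move=> PN N_gt0; have := harmonic_sum_periodic_le L (periodicC PN) N_gt0.
have := harmonic_sumC P L; have := window_countC P 0 N.
move=> /(congr1 (fun n => n%:R : R)); rewrite natrD => cE hE.
have N0 : (N%:R : R) != 0 by rewrite pnatr_eq0 -lt0n.
have -> : (window_count (fun z => ~~ P z) 0 N)%:R / N%:R
    = 1 - (window_count P 0 N)%:R / N%:R :> R.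
  by rewrite -[X in X - _](divff N0) -mulrBl -cE addrAC subrr add0r.
by rewrite -hE; nra.
Qed.

End HarmonicSum.

(** * The sieve limit and the Davenport-Erdos inequality *)

Lemma sum_multiples (F : nat -> nat) (d m : nat) : (0 < d)%N ->
  (forall x, ~~ (d %| x)%N -> F x = 0%N) ->
  (\sum_(x < d * m) F x = \sum_(y < m) F (d * y))%N.
Proof.
case: d => // d _ F0; elim: m => [|m IH]; first by rewrite muln0 !big_ord0.
rewrite mulnSr big_split_ord/= IH [RHS]big_ord_recr/=; congr addn.
rewrite big_ord_recl/= addn0 big1 ?addn0// => j _; apply: F0.
rewrite dvdn_addr ?dvdn_mulr// /bump add1n; apply/negP => /(dvdn_leq (ltn0Sn _)).
by rewrite ltnS leqNgt ltn_ord.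
Qed.

(** Sorting the residues [x] by the value of their gcd with [M]. *)
Lemma sum_gcdn (R : realFieldType) (h : nat -> R) (M L : nat) : (0 < M)%N ->
  gcd_sum (fun d => h d * (d <= L)%:R) M =
  \sum_(1 <= d < L.+1) h d * (\sum_(x < M) (gcdn x M == d))%N%:R.
Proof.
move=> M_gt0; under [RHS]eq_bigr => d _ do rewrite natr_sum mulr_sumr.
rewrite exchange_big/=; apply: eq_bigr => x _.
have g_gt0 : (0 < gcdn x M)%N by rewrite gcdn_gt0 M_gt0 orbT.
have [gL|gL] := leqP (gcdn x M) L.
  rewrite (bigD1_seq (gcdn x M)) ?iota_uniq ?mem_index_iota ?g_gt0//=.
  rewrite eqxx big1 ?addr0// => d /negbTE; rewrite eq_sym => ->.
  by rewrite mulr0.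
rewrite mulr0 big_nat big1// => d /andP[_ dL].
by rewrite gtn_eqF ?mulr0// (leq_trans _ gL).
Qed.

(** With [F = L!] and [d <= L], the integers [F] and [F ^ 2 / d] have the same
    prime divisors, so coprimality to either is the same condition. The count is
    thus exactly inversely proportional to [d]. *)
Lemma count_gcdn_fact_sqr (L d : nat) : (0 < d <= L)%N ->
  (d * (\sum_(x < L`! ^ 2) (gcdn x (L`! ^ 2) == d)) = L`! * totient L`!)%N.
Proof.
move=> /andP[d_gt0 dL]; set F := L`!.
have dF : (d %| F)%N by rewrite dvdn_fact// d_gt0.
have F_gt0 : (0 < F)%N by exact: fact_gt0.
pose q := (F %/ d)%N; have FE : F = (d * q)%N by rewrite mulnC divnK.
have q_gt0 : (0 < q)%N by rewrite divn_gt0// dvdn_leq.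
have ME : (F ^ 2 = d * (q * F))%N by rewrite expnS expn1 {1}FE mulnA.
rewrite ME (sum_multiples (F := fun x => gcdn x (d * (q * F)) == d))//; last first.
  by move=> x; apply: contraNeq; rewrite eqb0 negbK => /eqP <-; exact: dvdn_gcdl.
have -> : (\sum_(y < q * F) (gcdn (d * y) (d * (q * F)) == d) =
    \sum_(y < q * F) (coprime F (y %% F)))%N.
  apply: eq_bigr => y _; congr nat_of_bool.
  rewrite -muln_gcdr -{2}(muln1 d) eqn_pmul2l// coprime_modr.
  rewrite -/(coprime y (q * F)) coprimeMr [RHS]coprime_sym.
  have [Fy|] := boolP (coprime y F); rewrite ?andbF// andbT.
  by apply: coprime_dvdr Fy; rewrite FE dvdn_mull.
rewrite totient_count_coprime big_mkord.
suff -> : (\sum_(y < q * F) coprime F (y %% F) =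
    q * \sum_(y < F) coprime F y)%N by rewrite mulnA -FE.
elim: q {FE ME q_gt0} => [|q IH]; first by rewrite !mul0n big_ord0.
rewrite !mulSn addnC big_split_ord/= IH addnC; congr addn.
by apply: eq_bigr => y _; rewrite modnMDl modn_small.
Qed.

Definition divisors_in (A : set nat) (M : nat) : set nat :=
  [set a | A a /\ (a %| M)%N].

Definition sifted (A : set nat) (z : int) : bool := z \in Defs.free A.

Lemma siftedP (A : set nat) (z : int) :
  reflect (forall a, A a -> ~~ (a%:Z %| z)%Z) (sifted A z).
Proof.
apply: (iffP idP); rewrite /sifted inE /Defs.free/= /multiples/=.
  by move=> nz a Aa; apply/negP => az; apply: nz; exists a.
by move=> nz [a /nz/negP].
Qed.

Lemma siftedPn (A : set nat) (z : int) :
  reflect (exists2 a, A a & (a%:Z %| z)%Z) (~~ sifted A z).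
Proof.
apply: (iffP idP); last by move=> [a Aa az]; apply/siftedP => /(_ _ Aa)/negP.
by rewrite /sifted notin_setE /Defs.free/= => /contrapT.
Qed.

Lemma sifted_sub (A A' : set nat) (z : int) :
  A `<=` A' -> sifted A' z -> sifted A z.
Proof. by move=> AA' /siftedP sz; apply/siftedP => a /AA'/sz. Qed.

Lemma divisors_in_sub (A : set nat) (M : nat) : divisors_in A M `<=` A.
Proof. by move=> a []. Qed.

Lemma divisors_in_setS (A A' : set nat) (M : nat) :
  A `<=` A' -> divisors_in A M `<=` divisors_in A' M.
Proof. by move=> AA' a [/AA' A'a aM]. Qed.

Lemma divisors_in_dvdn (A : set nat) (M M' : nat) :
  (M %| M')%N -> divisors_in A M `<=` divisors_in A M'.
Proof. by move=> MM' a [Aa aM]; split => //; exact: dvdn_trans aM MM'. Qed.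

Lemma sifted_periodic (A : set nat) (M : nat) :
  periodic (sifted (divisors_in A M)) M.
Proof.
move=> z; apply/siftedP/siftedP => sz a Aa; have := sz a Aa;
  by rewrite rpredDr// dvdzE; case: Aa.
Qed.

(** Sieving by the divisors of [M], rather than by the elements of [A] below a
    bound, makes the sifted set [M]-periodic. *)
Definition sieve_density (R : realType) (A : set nat) (M : nat) : R :=
  (window_count (sifted (divisors_in A M)) 0 M)%:R / M%:R.

Definition sieve_limit (R : realType) (A : set nat) : R :=
  inf [set sieve_density R A M | M in [set M | (0 < M)%N]].

Section SieveDensity.
Context {R : realType}.
Implicit Types (A B : set nat) (M Q : nat).
Notation sd := (sieve_density R).
Notation sl := (sieve_limit R).

Lemma sieve_density_ge0 A M : 0 <= sd A M.
Proof. exact: divr_ge0. Qed.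

Lemma window_count_periodic (P : int -> bool) (N M : nat) (k : int) :
  periodic P N -> (0 < N)%N -> (N %| M)%N ->
  (window_count P k M)%:R = (window_count P 0 N)%:R / N%:R * M%:R :> R.
Proof.
move=> PN N_gt0 /dvdnP[q ->]; rewrite (window_count_periods q k PN) !natrM.
by rewrite mulrC -mulrA; congr (_ * _); rewrite mulrC mulfK// pnatr_eq0 -lt0n.
Qed.

Lemma window_count_sifted A M Q (k : int) : (0 < M)%N -> (M %| Q)%N ->
  (window_count (sifted (divisors_in A M)) k Q)%:R = sd A M * Q%:R :> R.
Proof. by move=> *; apply: window_count_periodic => //; exact: sifted_periodic. Qed.

Lemma sieve_density_le_sub (A A' : set nat) (M M' : nat) :
  (0 < M)%N -> (0 < M')%N -> divisors_in A M `<=` divisors_in A' M' ->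
  sd A' M' <= sd A M.
Proof.
move=> M_gt0 M'_gt0 AA'.
have Q_gt0 : (0 : R) < (M * M')%N%:R by rewrite ltr0n muln_gt0 M_gt0.
rewrite -(ler_pM2r Q_gt0).
rewrite -(window_count_sifted A 0 M_gt0 (dvdn_mulr _ (dvdnn M))).
rewrite -(window_count_sifted A' 0 M'_gt0 (dvdn_mull _ (dvdnn M'))).
by rewrite ler_nat; apply: window_count_sub => z; exact: sifted_sub.
Qed.

Lemma sieve_density_dvdn A M Q : (0 < Q)%N -> (M %| Q)%N -> sd A Q <= sd A M.
Proof.
move=> Q_gt0 MQ; apply: sieve_density_le_sub => //; first exact: dvdn_gt0 MQ.
exact: divisors_in_dvdn.
Qed.

Lemma sieve_density_setS A B M : (0 < M)%N -> A `<=` B -> sd B M <= sd A M.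
Proof.
by move=> M_gt0 AB; apply: sieve_density_le_sub => //; exact: divisors_in_setS.
Qed.

Let has_inf_sd A : has_inf [set sd A M | M in [set M | (0 < M)%N]].
Proof.
split; first by exists (sd A 1); exists 1%N.
by exists 0 => _ [M _ <-]; exact: sieve_density_ge0.
Qed.

Lemma sieve_limit_le A M : (0 < M)%N -> sl A <= sd A M.
Proof. by move=> M_gt0; apply: ge_inf; [case: (has_inf_sd A)|exists M]. Qed.

Lemma sieve_limit_ge A (e : R) :
  (forall M, (0 < M)%N -> e <= sd A M) -> e <= sl A.
Proof.
move=> eA; apply: lb_le_inf; first by case: (has_inf_sd A).
by move=> _ [M M_gt0 <-]; exact: eA.
Qed.

Lemma sieve_limit_ge0 A : 0 <= sl A.
Proof. by apply: sieve_limit_ge => M _; exact: sieve_density_ge0. Qed.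

Lemma sieve_limit_adherent A (e : R) : 0 < e ->
  exists2 M, (0 < M)%N & sd A M < sl A + e.
Proof.
move=> e_gt0; have [_ [M M_gt0 <-]] := inf_adherent e_gt0 (has_inf_sd A).
by exists M.
Qed.

Lemma sieve_limit_setS A B : A `<=` B -> sl B <= sl A.
Proof.
move=> AB; apply: sieve_limit_ge => M M_gt0.
exact: le_trans (sieve_limit_le B M_gt0) (sieve_density_setS M_gt0 AB).
Qed.

(** For [x] uniform modulo [F ^ 2], where [F = L!], the variable [d = gcd x (F ^ 2)]
    takes each value at most [L] with probability proportional to [1 / d]. Being
    without divisor in [A] and being at most [L] are both inherited by divisors,
    so Harris' inequality applies to them; conditioned on [d <= L], it is the
    claim. *)
Lemma harmonic_sum_sifted_ge A L :
  sl A * harmonic_sum R predT L <= harmonic_sum R (sifted A) L.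
Proof.
set F := L`!; set M := (F ^ 2)%N.
have F_gt0 : (0 < F)%N by exact: fact_gt0.
have M_gt0 : (0 < M)%N by rewrite expn_gt0 F_gt0.
apply: (@le_trans _ _ (sd A M * harmonic_sum R predT L)).
  by rewrite ler_wpM2r ?harmonic_sum_ge0// sieve_limit_le.
pose f (d : nat) : R := (sifted A d%:Z)%:R; pose g (d : nat) : R := (d <= L)%:R.
have fP : div_antitone f.
  move=> d n n_gt0 dn; rewrite /f ler_nat.
  suff : sifted A n%:Z -> sifted A d%:Z by case: (sifted A n) => // ->.
  move=> /siftedP sn; apply/siftedP => a /sn; apply: contra => ad.
  exact: dvdz_trans ad _.
have gP : div_antitone g.
  move=> d n n_gt0 dn; rewrite /g ler_nat; have := dvdn_leq n_gt0 dn.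
  by case: (leqP n L) => // nL /leq_trans ->.
have fE : gcd_sum f M = (window_count (sifted (divisors_in A M)) 0 M)%:R.
  rewrite natr_sum; apply: eq_bigr => x _; congr (_%:R); congr nat_of_bool.
  rewrite add0r; apply/siftedP/siftedP => sx a.
    move=> [/sx + aM]; apply: contra => ax.
    by move: ax; rewrite !dvdzE !absz_nat dvdn_gcd => ->.
  move=> Aa; apply/negP; rewrite dvdzE !absz_nat dvdn_gcd => /andP[ax aM].
  by have /negP := sx a (conj Aa aM); rewrite dvdzE.
have cE d : (0 < d <= L)%N ->
    (\sum_(x < M) (gcdn x M == d))%N%:R = (F * totient F)%:R / d%:R :> R.
  move=> dL; rewrite -(count_gcdn_fact_sqr dL) natrM mulrC mulKf// pnatr_eq0.
  by case: d dL.
have sumE h : gcd_sum (fun d => h d * (d <= L)%:R) M =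
    (F * totient F)%:R * \sum_(1 <= d < L.+1) h d * (d%:R)^-1 :> R.
  rewrite sum_gcdn// mulr_sumr; apply: eq_big_nat => d dL.
  by rewrite cE; [ring|rewrite -ltnS].
have := harris M_gt0 fP gP; rewrite fE sumE.
have -> : gcd_sum g M = gcd_sum (fun d => 1 * (d <= L)%:R) M.
  by apply: eq_bigr => x _; rewrite mul1r.
rewrite sumE.
have C_gt0 : (0 : R) < (F * totient F)%:R by rewrite ltr0n muln_gt0 F_gt0 totient_gt0.
rewrite mulrCA [leRHS]mulrCA ler_pM2l//.
rewrite harmonic_sum_mkcond [harmonic_sum R (sifted A) L]harmonic_sum_mkcond.
by rewrite mulrAC ler_pdivrMr ?ltr0n// => /le_trans -> //; rewrite mulrC.
Qed.

Lemma harmonic_sum_le_ln L : (0 < L)%N ->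
  harmonic_sum R predT L <= 1 + ln (L%:R : R).
Proof.
case: L => // L _; elim: L => [|L IH].
  by rewrite harmonic_sum_recr /harmonic_sum big_nil ln1 addr0 add0r mul1r invr1.
rewrite harmonic_sum_recr mul1r.
have L1 : (0 : R) < L.+1%:R by rewrite ltr0n.
have L2 : (0 : R) < L.+2%:R by rewrite ltr0n.
have /le_ln1Dx : - 1 < - (L.+2%:R)^-1 :> R.
  by rewrite ltrN2 invf_lt1// ltr1n.
have -> : 1 + - (L.+2%:R)^-1 = L.+1%:R / L.+2%:R :> R.
  by rewrite -[L.+2%:R]natr1; field; apply: lt0r_neq0; move: L1; lra.
rewrite ln_div ?posrE//; move: IH.
move: (ln L.+1%:R) (ln L.+2%:R) (L.+2%:R^-1) (harmonic_sum _ _ _) => a b c d; lra.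
Qed.

Lemma harmonic_sum_ge_ln L : ln (L.+1%:R : R) <= harmonic_sum R predT L.
Proof.
elim: L => [|L IH]; first by rewrite ln1 harmonic_sum_ge0.
rewrite harmonic_sum_recr mul1r.
have L1 : (0 : R) < L.+1%:R by rewrite ltr0n.
have L2 : (0 : R) < L.+2%:R by rewrite ltr0n.
have /le_ln1Dx : - 1 < (L.+1%:R)^-1 :> R.
  by apply: lt_trans (_ : 0 < _); rewrite ?ltrN10// invr_gt0.
have -> : 1 + (L.+1%:R)^-1 = L.+2%:R / L.+1%:R :> R.
  by rewrite -[L.+2%:R]natr1; field; apply: lt0r_neq0; move: L1; lra.
rewrite ln_div ?posrE//; move: IH.
move: (ln L.+1%:R) (ln L.+2%:R) (L.+1%:R^-1) (harmonic_sum _ _ _) => a b c d; lra.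
Qed.

Lemma near_ln_ge (e : R) : \forall L \near \oo, e <= ln (L%:R : R).
Proof.
near=> L.
have eL : expR e <= L%:R by near: L; exact: nbhs_infty_ger.
by rewrite -[e]expRK ler_ln ?posrE ?expR_gt0// (lt_le_trans (expR_gt0 e)).
Unshelve. all: by end_near. Qed.

(** If the sieve limit were [t > 0], the logarithmic means of the multiples would
    be at most [1 - t] up to the factor [1 + 1 / ln L]. *)
Lemma behrend_sieve_limit A : behrend R A -> sl A = 0.
Proof.
move=> [_ A1]; apply/eqP; rewrite eq_le sieve_limit_ge0 andbT leNgt.
apply/negP; set t := sl A => t_gt0.
have : \forall L \near \oo, 1 - t / 2 < log_mean R (multiples A) L.
  by apply: (cvgr_gt 1) => //; rewrite gtrBl divr_gt0.
case/filterI/(_ (near_ln_ge (2 / t))) => N _ HN.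
have [/=] := HN (N + 2)%N (leq_addr _ _).
set L := (N + 2)%N; rewrite /log_mean => mL tL.
have l_gt0 : 0 < ln (L%:R : R) by apply: lt_le_trans tL; rewrite divr_gt0.
move: mL; rewrite ltNge => /negP; apply; rewrite ler_pdivrMl//.
have := harmonic_sum_sifted_ge A L; rewrite -/t.
have := harmonic_sumC (R := R) (sifted A) L.
have -> : harmonic_sum R (fun z => ~~ sifted A z) L =
    \sum_(1 <= l < L.+1 | (l%:Z : int) \in multiples A) (l%:R : R)^-1.
  apply: eq_bigl => l; apply/siftedPn/idP; rewrite inE//.
have L_gt0 : (0 < L)%N by rewrite /L addn2.
have := harmonic_sum_le_ln L_gt0.
have : t <= 1.
  apply: le_trans (sieve_limit_le A (ltn0Sn 0)) _.
  by rewrite /sieve_density divr1 -(mulr1n 1) ler_nat window_count_le.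
move: tL; rewrite ler_pdivrMr//; set H := harmonic_sum _ predT _.
set S := harmonic_sum _ _ _; set T := \sum_(_ <= _ < _ | _) _.
set l := ln _ in l_gt0 *; move=> tl t1 Hl HE tH.
have := mulr_ge0 (_ : 0 <= 1 - t) (_ : 0 <= 1 + l - H).
by rewrite !subr_ge0 => /(_ t1 Hl); nra.
Qed.

(** A multiple [c * y] of [c] without divisor in [B] has [y] without divisor in
    [A]; such [y] have arbitrarily small density. *)
Lemma sieve_limit_add1 A B (c : nat) : (0 < c)%N -> sl A = 0 ->
  (muln c) @` A `<=` B -> sl (B `|` [set c]) = sl B.
Proof.
move=> c_gt0 A0 cAB; apply/eqP; rewrite eq_le sieve_limit_setS//=.
apply: sieve_limit_ge => M M_gt0; apply/ler_addgt0Pl => e e_gt0.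
have [M1 M1_gt0] := sieve_limit_adherent A e_gt0; rewrite A0 add0r => M1e.
pose Q := (c * (M1 * M))%N.
have Q_gt0 : (0 < Q)%N by rewrite !muln_gt0 c_gt0 M1_gt0.
have MQ : (M %| Q)%N by rewrite !dvdn_mull.
apply: le_trans (sieve_limit_le B Q_gt0) _.
rewrite ler_pdivrMr ?ltr0n// mulrDl.
rewrite (window_count_split _ (sifted (divisors_in (B `|` [set c]) M))).
rewrite natrD addrC lerD//; last first.
  rewrite -(window_count_sifted _ 0 M_gt0 MQ) ler_nat.
  by apply: window_count_sub => z /andP[].
pose P z := (c%:Z %| z)%Z && sifted (divisors_in A M1) (z %/ c)%Z.
apply: (@le_trans _ _ (window_count P 0 Q)%:R).
  rewrite ler_nat; apply: window_count_sub => z /andP[/siftedP sB /siftedPn[b]].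
  move=> [[Bb|->] bM] bz.
    by have /negP[] := sB b (conj Bb (dvdn_trans bM MQ)).
  rewrite /P bz/=; apply/siftedP => a [Aa aM1]; apply/negP => az.
  have /negP[] : ~~ ((c * a)%N%:Z %| z)%Z.
    by apply: sB; split; [apply: cAB; exists a|rewrite dvdn_mul// dvdn_mulr].
  by rewrite -(divzK bz) PoszM mulrC dvdz_mul.
have -> : window_count P 0 Q = window_count (sifted (divisors_in A M1)) 0 (M1 * M).
  rewrite /window_count (sum_multiples (F := fun x => P (0 + x%:Z)))//; last first.
    by move=> x /negbTE; rewrite /P add0r dvdzE/= => ->.
  apply: eq_bigr => y _; rewrite /P !add0r PoszM dvdz_mulr//= mulKz//.
  by rewrite lt0r_neq0// ltz_nat.
rewrite window_count_sifted ?dvdn_mulr//.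
apply: ler_pM => //; [exact: sieve_density_ge0|exact: ltW|].
by rewrite ler_nat leq_pmull.
Qed.

(** Only finitely many elements of [C] divide a given [M], and they are added one
    at a time. *)
Lemma sieve_limit_setU B (C : set nat) :
  (forall c, C c -> (0 < c)%N /\ exists2 A, sl A = 0 & (muln c) @` A `<=` B) ->
  sl (B `|` C) = sl B.
Proof.
move=> CP; pose Cn n := [set c | C c /\ (c <= n)%N].
have step n : sl (B `|` Cn n) = sl B.
  elim: n => [|n IH].
    congr sl; apply/seteqP; split => [b [//|[/CP[]]]|b]; last by left.
    by case: b.
  have [Cn1|Cn1] := pselect (C n.+1); last first.
    rewrite -IH; congr sl; apply/seteqP; split => b [|[Cb bn]]; try by left.
      right; split => //; move: bn; rewrite leq_eqVlt => /predU1P[bn|//].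
      by rewrite bn in Cb.
    by right; split => //; exact: leqW.
  have -> : B `|` Cn n.+1 = (B `|` Cn n) `|` [set n.+1].
    apply/seteqP; split => b /=.
      move=> [Bb|[Cb]]; first by left; left.
      rewrite leq_eqVlt => /predU1P[->|bn]; first by right.
      by left; right.
    move=> [[Bb|[Cb bn]]|->]; [by left|right..]; split => //; exact: leqW.
  have [_ [A A0 cA]] := CP _ Cn1.
  rewrite (sieve_limit_add1 (A := A))// => x /cA; by left.
apply/eqP; rewrite eq_le sieve_limit_setS//=.
apply: sieve_limit_ge => M M_gt0; rewrite -(step M).
apply: le_trans (sieve_limit_le _ M_gt0) _.
rewrite ler_wpM2r// ler_nat; apply: window_count_sub => z; apply: sifted_sub.
move=> b [[Bb|Cb] bM]; split => //; [by left|right; split => //].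
exact: dvdn_leq.
Qed.

End SieveDensity.

(** For [t] take the part of [n] made of the primes that do not divide [r]: each
    prime divisor of [n] then divides exactly one of [r] and [t * N]. *)
(** * Cofactors of infinite coprime sets *)

Lemma coprime_prog (r N n : nat) : (0 < r)%N -> (0 < n)%N -> coprime r N ->
  exists t, coprime (r + t * N) n.
Proof.
move=> r_gt0 n_gt0 rN; pose t := (n`_(negn \pi(r)))%N; exists t.
have [/eqP n1|] := eqVneq n 1%N.
  by rewrite (eqP n1) coprimen1.
move=> n1; rewrite coprime_has_primes ?addn_gt0 ?r_gt0//.
apply/hasPn => p; rewrite !mem_primes => /and3P[p_prime _ pn].
apply/negP => /and3P[_ _]; have [pr|pr] := boolP (p %| r)%N.
  rewrite dvdn_addr// Euclid_dvdM// => /orP[|pN].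
    have /pnatP : (negn \pi(r)).-nat t by exact: part_pnat.
    rewrite part_gt0 => /(_ isT p p_prime) + pt => /(_ pt).
    by rewrite inE mem_primes p_prime r_gt0 pr.
  have : (p %| gcdn r N)%N by rewrite dvdn_gcd pr.
  by rewrite (eqP rN) dvdn1 => /eqP p1; rewrite p1 in p_prime.
suff pt : (p %| t)%N by rewrite dvdn_addl ?dvdn_mulr// (negbTE pr).
have : (p`_(negn \pi(r)) %| t)%N by exact: partn_dvd.
by rewrite part_pnat_id// pnatE// inE mem_primes p_prime r_gt0 (negbTE pr).
Qed.

Definition coprime_cofactors (B : set nat) : set nat :=
  [set d | posn d /\ exists A : set nat,
    [/\ A `<=` posn, infinite_set A, pairwise_coprime A & (muln d) @` A `<=` B]].

Definition behrend_cofactors (R : realType) (B : set nat) : set nat :=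
  [set c | posn c /\ exists2 A : set nat, behrend R A & (muln c) @` A `<=` B].

(** Pairwise coprime elements that share a prime with [n] pick distinct prime
    divisors of [n], of which there are at most [n]. *)
Lemma coprime_avoid (A : set nat) (n : nat) :
  infinite_set A -> pairwise_coprime A -> (0 < n)%N ->
  exists2 a, A a & coprime a n.
Proof.
move=> Ainf Aco n_gt0; apply: contrapT => nocop.
have [F FA] := infinite_set_fset n.+2 Ainf; set s := (X in size X) => sn.
have sA a : a \in s -> A a by exact: FA.
pose f a := pdiv (gcdn a n).
have fP a : A a -> prime (f a) /\ (f a %| gcdn a n)%N.
  move=> Aa; split; last exact: pdiv_dvd.
  rewrite pdiv_prime// ltn_neqAle gcdn_gt0 n_gt0 orbT andbT eq_sym.
  by apply/negP => an; apply: nocop; exists a.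
have finj : {in s &, injective f}.
  move=> a b /sA Aa /sA Ab fab; apply: contrapT => /(Aco _ _ Aa Ab) ab.
  have [pa ga] := fP _ Aa; have [_ gb] := fP _ Ab.
  have : (f a %| gcdn a b)%N.
    rewrite dvdn_gcd (dvdn_trans ga) ?dvdn_gcdl//=.
    by rewrite fab (dvdn_trans gb) ?dvdn_gcdl.
  by rewrite (eqP ab) dvdn1 => /eqP f1; rewrite f1 in pa.
have us : uniq (map f s) by rewrite map_inj_in_uniq ?finmap.fset_uniq.
have /(uniq_leq_size us) : {subset map f s <= iota 0 n.+1}.
  move=> _ /mapP[a /sA Aa ->]; rewrite mem_iota/= add0n ltnS.
  have [_ fg] := fP _ Aa; apply: dvdn_leq => //.
  exact: dvdn_trans fg (dvdn_gcdr _ _).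
by rewrite size_map size_iota leqNgt sn.
Qed.

(** Choose greedily an element coprime to the product of the preceding ones. *)
Lemma coprime_sequence (E : set nat) :
  (forall n, (0 < n)%N -> exists a, [/\ E a, (1 < a)%N & coprime a n]) ->
  exists A : set nat,
    [/\ A `<=` E, A `<=` posn, infinite_set A & pairwise_coprime A].
Proof.
move=> EP; have /choice[pk pkP] n : exists a,
    (0 < n)%N -> [/\ E a, (1 < a)%N & coprime a n].
  by case: n => [|n]; [exists 0%N|have [a aP] := EP n.+1 isT; exists a].
pose P := fix P i := if i is j.+1 then (P j * pk (P j))%N else 1%N.
have P_gt0 i : (0 < P i)%N.
  elim: i => //= i IH; rewrite muln_gt0 IH/=.
  by have [_ /ltnW] := pkP _ IH.
pose a i := pk (P i).
have aP i : [/\ E (a i), (1 < a i)%N & coprime (a i) (P i)] by exact: pkP.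
have aPdvd i j : (i < j)%N -> (a i %| P j)%N.
  elim: j => // j IH; rewrite ltnS leq_eqVlt => /predU1P[->|/IH ij] /=.
    by rewrite dvdn_mull.
  by rewrite dvdn_mulr.
have aco i j : (i < j)%N -> coprime (a i) (a j).
  move=> /aPdvd ij; rewrite coprime_sym; have [_ _] := aP j.
  exact: coprime_dvdr.
have ainj : injective a.
  move=> i j aij; apply/eqP; case: ltngtP => // /aco; rewrite aij /coprime gcdnn;
  by have [_ + _] := aP j => /gtn_eqF ->.
exists (range a); split.
- by move=> _ [i _ <-]; have [] := aP i.
- by move=> _ [i _ <-]; have [_ /ltnW] := aP i.
- move=> afin; apply: infinite_nat.
  by rewrite -(eq_finite_set (inj_card_eq (f := a) _))// => i j _ _ /ainj.
- move=> _ _ [i _ <-] [j _ <-] aij; case: (ltngtP i j) => [/aco//|/aco|ij].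
    by rewrite coprime_sym.
  by rewrite ij in aij.
Qed.

(** Otherwise every integer congruent to 1 modulo [n] is without divisor in [A]. *)
Lemma sieve_limit0_coprime (R : realType) (A : set nat) (n : nat) :
  sieve_limit R A = 0 -> (0 < n)%N -> exists2 a, A a & coprime a n.
Proof.
move=> A0 n_gt0; apply: contrapT => noco.
suff : (n%:R)^-1 <= sieve_limit R A by rewrite A0 leNgt invr_gt0 ltr0n n_gt0.
apply: sieve_limit_ge => M M_gt0.
have Mn_gt0 : (0 < M * n)%N by rewrite muln_gt0 M_gt0.
apply: le_trans (sieve_density_dvdn A Mn_gt0 (dvdn_mulr _ (dvdnn _))).
rewrite /sieve_density natrM ler_pdivlMr ?mulr_gt0 ?ltr0n//.
rewrite mulrCA mulVf ?mulr1 ?pnatr_eq0 -?lt0n// ler_nat.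
pose P (z : int) := (n%:Z %| z - 1)%Z.
have PN : periodic P n by exact: periodic_residue.
apply: (@leq_trans (window_count P 0 (M * n))).
  rewrite window_count_periods// leq_pmulr// -(window_count_period 1 PN).
  case: n n_gt0 {noco Mn_gt0} @P PN => // n _ P PN.
  by rewrite /window_count big_ord_recl /P addr0 subrr dvdz0.
apply: window_count_sub => z Pz; apply/siftedP => a [Aa _].
apply/negP => az; apply: noco; exists a => //; rewrite /coprime -dvdn1.
set g := gcdn a n.
have gz : (g%:Z %| z)%Z by apply: dvdz_trans az; rewrite dvdzE dvdn_gcdl.
have gz1 : (g%:Z %| z - 1)%Z by apply: dvdz_trans Pz; rewrite dvdzE dvdn_gcdr.
have : (g%:Z %| z - (z - 1))%Z by rewrite rpredB.
by rewrite opprB addrC subrK dvdzE.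
Qed.

(** A Behrend set without the element 1 has elements coprime to any given integer,
    hence contains an infinite pairwise coprime set. *)
Lemma behrend_cofactors_sub (R : realType) (B : set nat) :
  behrend_cofactors R B `<=` B `|` coprime_cofactors B.
Proof.
move=> c [c_gt0 [A AB cAB]].
have [A1|A1] := pselect (A 1%N).
  by left; apply: cAB; exists 1%N => //; rewrite muln1.
have A_posn : A `<=` posn by case: AB.
right; split=> //.
have [|S [SA Sp Sinf Sco]] := @coprime_sequence A.
  move=> n n_gt0; have [a Aa an] := sieve_limit0_coprime (behrend_sieve_limit AB) n_gt0.
  exists a; split=> //; rewrite ltn_neqAle (A_posn _ Aa) andbT.
  by apply/eqP => a1; apply: A1; rewrite a1.
by exists S; split=> //; apply: subset_trans cAB; exact: image_subset.
Qed.

(** The coprime cofactors of [B] are stable under a second round: when [h * q] is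
    itself a cofactor, with coprime set [A], use [q * a] with a suitable [a] in
    [A]. *)
Lemma coprime_cofactorsU (B : set nat) (h : nat) : B `<=` posn -> (0 < h)%N ->
  (forall n, (0 < n)%N -> exists q,
    [/\ (B `|` coprime_cofactors B) (h * q)%N, (1 < q)%N & coprime q n]) ->
  coprime_cofactors B h.
Proof.
move=> B_posn h_gt0 hP; split => //.
have [|S [SB Sp Sinf Sco]] := @coprime_sequence [set q | B (h * q)%N].
  move=> n n_gt0; have [q [[Bhq|[_ [A [Ap Ainf Aco hqA]]]] q1 qn]] := hP n n_gt0.
    by exists q.
  have [a Aa an] := coprime_avoid Ainf Aco n_gt0.
  exists (q * a)%N; split.
  - by rewrite /= mulnA; apply: hqA; exists a.
  - by rewrite (leq_trans q1)// leq_pmulr// Ap.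
  - by rewrite coprimeMl qn.
by exists S; split=> // _ [q /SB Bhq <-].
Qed.

(** Let [g] be the gcd of [r] and [N]. If no [e] divides [g], the class contains
    some [g * y] with [y] coprime to any prescribed integer, and a divisor
    [b = h * q] of it with [h = gcd b g] has [q > 1] dividing [y]. As [h] has
    finitely many values, one of them is the cofactor of infinitely many coprime
    [q], hence lies in the set after all. *)
Lemma sifted_residue_class (B : set nat) (N : nat) (r : int) :
  B `<=` posn -> (0 < N)%N ->
  (forall z, (N%:Z %| z - r)%Z -> ~~ sifted (B `|` coprime_cofactors B) z) ->
  exists e, [/\ (B `|` coprime_cofactors B) e, (e %| N)%N & (e%:Z %| r)%Z].
Proof.
move=> B_posn N_gt0; set D := _ `|` _ => nosift.
have D_posn : D `<=` posn by move=> d [/B_posn|[]].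
pose r0 := (`|(r %% N)%Z| + N)%N.
have r0E : (N%:Z %| r0%:Z - r)%Z.
  rewrite /r0 PoszD gez0_abs ?modz_ge0 -?lt0n_neq0//; last by rewrite eqz_nat -lt0n.
  by rewrite addrAC rpredDr// -eqz_mod_dvd modz_mod.
have r0_gt0 : (0 < r0)%N by rewrite addn_gt0 N_gt0 orbT.
pose g := gcdn r0 N.
have g_gt0 : (0 < g)%N by rewrite gcdn_gt0 N_gt0 orbT.
suff [e [De eg]] : exists e, D e /\ (e %| g)%N.
  exists e; split => //; first exact: dvdn_trans eg (dvdn_gcdr _ _).
  have er0 : (e%:Z %| r0%:Z)%Z by rewrite dvdzE (dvdn_trans eg)// dvdn_gcdl.
  have eN : (e%:Z %| r0%:Z - r)%Z.
    by apply: dvdz_trans r0E; rewrite dvdzE (dvdn_trans eg)// dvdn_gcdr.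
  have -> : r = r0%:Z - (r0%:Z - r) by ring.
  by rewrite rpredB.
apply: contrapT => noe.
have hP (h : nat) : exists n, (0 < n)%N /\ ((h %| g)%N ->
    forall q, D (h * q)%N -> (1 < q)%N -> ~~ coprime q n).
  have [hg|hg] := boolP (h %| g)%N; last by exists 1%N.
  have h_gt0 : (0 < h)%N by exact: dvdn_gt0 hg.
  apply: contrapT => nh; apply: noe; exists h; split => //; right.
  apply: coprime_cofactorsU => // n n_gt0; apply: contrapT => nq.
  apply: nh; exists n; split => // _ q Dq q1; apply/negP => qn.
  by apply: nq; exists q.
have [n nP] := choice hP.
(* For [h] dividing [g], no [q > 1] with [h * q] in [D] is coprime to [n h]. *)
pose Pn := (\prod_(h < g.+1) n h)%N.
have Pn_gt0 : (0 < Pn)%N by rewrite prodn_gt0// => h; case: (nP h).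
have r0gE : r0 = (g * (r0 %/ g))%N by rewrite mulnC divnK// dvdn_gcdl.
have NgE : N = (g * (N %/ g))%N by rewrite mulnC divnK// dvdn_gcdr.
have [|||t tP] := @coprime_prog (r0 %/ g) (N %/ g) Pn => //.
- by rewrite divn_gt0// dvdn_leq// dvdn_gcdl.
- rewrite /coprime -(eqn_pmul2l g_gt0) muln1 muln_gcdr -r0gE -NgE.
  exact/eqP.
set y := (_ + _)%N in tP.
have : ~~ sifted D (g * y)%N%:Z.
  apply: nosift.
  have -> : (g * y = r0 + t * N)%N by rewrite /y mulnDr -r0gE mulnCA -NgE.
  by rewrite PoszD addrAC rpredDr// PoszM dvdz_mull.
case/siftedPn => b Db; rewrite dvdzE/= => bgy.
pose h := gcdn b g; pose q := (b %/ h)%N.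
have b_gt0 : (0 < b)%N by exact: D_posn.
have hg : (h %| g)%N by exact: dvdn_gcdr.
have h_gt0 : (0 < h)%N by exact: dvdn_gt0 hg.
have bE : b = (h * q)%N by rewrite mulnC divnK// dvdn_gcdl.
have qy : (q %| y)%N.
  have gE : g = (h * (g %/ h))%N by rewrite mulnC divnK.
  have qco : coprime q (g %/ h).
    by rewrite /coprime -(eqn_pmul2l h_gt0) muln1 muln_gcdr -bE -gE.
  by rewrite -(Gauss_dvdr y qco) -(dvdn_pmul2l h_gt0) mulnA -bE -gE.
have q_gt0 : (0 < q)%N by move: b_gt0; rewrite bE muln_gt0 => /andP[].
have [q1|q1] := leqP q 1.
  apply: noe; exists b; split => //.
  by rewrite bE (_ : q = 1)%N ?muln1//; apply/eqP; rewrite eqn_leq q1.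
have [_ /(_ hg q)] := nP h; rewrite -bE => /(_ Db q1)/negP; apply.
apply: coprime_dvdl qy _; apply: coprime_dvdr tP.
have hg1 : (h < g.+1)%N by rewrite ltnS dvdn_leq.
by rewrite /Pn (bigD1 (Ordinal hg1))//= dvdn_mulr.
Qed.

(** Every element is a multiple of a minimal one, by descent. *)
Lemma multiples_primitive_part (A : set nat) : A `<=` posn ->
  multiples (primitive_part A) = multiples A.
Proof.
move=> A_posn; apply/seteqP; split => z [a]; first by move=> [Aa _] az; exists a.
have [n] := ubnP a; elim: n a => // n IH a; rewrite ltnS => an Aa az.
have [pa|pa] := pselect (primitive_part A a); first by exists a.
have [b [Ab ba bna]] : exists b, [/\ A b, (b %| a)%N & b <> a].
  apply: contrapT => nb; apply: pa; split => // b Ab ba.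
  by apply: contrapT => bna; apply: nb; exists b.
apply: (IH b) => //.
- apply: leq_trans an; rewrite ltn_neqAle dvdn_leq ?A_posn// andbT.
  exact/eqP.
- by apply: dvdz_trans az; rewrite dvdzE.
Qed.

Lemma eta_sifted (A : set nat) (i : int) : eta A i = sifted A i.
Proof. by []. Qed.

Lemma eta_primitive_part (A : set nat) (i : int) : A `<=` posn ->
  eta (primitive_part A) i = sifted A i.
Proof.
by move=> A_posn; rewrite eta_sifted /sifted /Defs.free multiples_primitive_part.
Qed.

(** * Periods of a regular Toeplitz sequence *)

Lemma density_periodic (R : realType) (A : set int) (N : nat) :
  periodic (fun z => z \in A) N -> (0 < N)%N ->
  density R A = (window_count (fun z => z \in A) 0 N)%:R / N%:R.
Proof.
set P := fun z => _; move=> PN N_gt0; apply/cvg_lim => //.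
set c := _ / _.
have N0 : (0 : R) < N%:R by rewrite ltr0n.
have countE L : (\sum_(1 <= l < L.+1) ((l%:Z : int) \in A))%N = window_count P 1 L.
  rewrite big_add1 big_mkord/=; apply: eq_bigr => l _.
  by rewrite /P -addn1 PoszD addrC.
have bound L : `|(window_count P 1 L)%:R - c * L%:R| <= N%:R.
  rewrite {1 2}(divn_eq L N) window_count_cat natrD.
  rewrite (window_count_periods _ _ PN).
  set w := window_count P _ (L %% N)%N.
  have w0 : w%:R <= N%:R :> R.
    by rewrite ler_nat (leq_trans (window_count_le _ _ _))// ltnW// ltn_pmod.
  have m0 : (L %% N)%N%:R <= N%:R :> R by rewrite ler_nat ltnW// ltn_pmod.
  have c01 : 0 <= c <= 1.
    by rewrite divr_ge0// ler_pdivrMr// mul1r ler_nat window_count_le.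
  have -> : (L %/ N * window_count P 0 N)%N%:R + w%:R - c * (L %/ N * N + L %% N)%N%:R
     = w%:R - c * (L %% N)%N%:R :> R.
    rewrite natrD !natrM /c; field; exact: lt0r_neq0.
  have w1 : 0 <= w%:R :> R by [].
  have m1 : 0 <= (L %% N)%N%:R :> R by [].
  by rewrite ler_norml; nra.
apply/cvgrPdist_le => e e_gt0; near=> L.
have L_gt0 : (0 : R) < L%:R.
  by rewrite ltr0n; near: L; exact: nbhs_infty_gt.
have NL : N%:R / e <= L%:R by near: L; exact: nbhs_infty_ger.
have -> : \sum_(1 <= l < L.+1) nat_of_bool ((l%:Z : int) \in A) = window_count P 1 L.
  exact: countE.
rewrite distrC -[c](mulfK (lt0r_neq0 L_gt0)) -mulrBl normrM normfV (gtr0_norm L_gt0).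
rewrite ler_pdivrMr//; apply: le_trans (bound L) _.
by rewrite mulrC -ler_pdivrMr.
Unshelve. all: by end_near. Qed.

Lemma per_dvdn (x : biseq) (s N : nat) : (s %| N)%N -> per x s `<=` per x N.
Proof.
move=> /dvdnP[q ->] i xi k; rewrite PoszM mulrAC mulrC; exact: xi.
Qed.

Lemma per_periodic (x : biseq) (s N : nat) : (s %| N)%N ->
  periodic (fun z => z \in per x s) N.
Proof.
move=> sN; apply: periodic_dvdn sN _ => z.
have xE : per x s (z + s%:Z) <-> per x s z.
  rewrite /per/=; split => H k.
    have := H (k - 1); have := H (- 1).
    rewrite mulrN1 addrK mulrBr mulr1.
    rewrite (_ : z + s%:Z + (s%:Z * k - s%:Z) = z + s%:Z * k); last by ring.
    by move=> <- <-.
  have := H (k + 1); have := H 1.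
  by rewrite mulr1 mulrDr mulr1 addrA addrAC => <- ->.
by apply/idP/idP; rewrite !inE => /xE.
Qed.

(** A common multiple of the periods up to [r] is a period for all positions that
    have one of these periods. *)
Lemma regular_toeplitz_period (R : realType) (x : biseq) (N0 : nat) (e : R) :
  regular_toeplitz R x -> (0 < N0)%N -> 0 < e ->
  exists N, [/\ (0 < N)%N, (N0 %| N)%N &
    (window_count (fun z => z \notin per x N) 0 N)%:R <= e * N%:R].
Proof.
move=> [_ xreg] N0_gt0 e_gt0.
have : \forall r \near \oo, 1 - e < density R (\bigcup_(s in [set s | (0 < s <= r)%N]) per x s).
  by apply: (cvgr_gt 1) => //; rewrite gtrBl.
case=> r _ /(_ r (leqnn r))/=; set U := \bigcup_(s in _) _ => Ue.
pose N := (N0 * r`!)%N; exists N.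
have N_gt0 : (0 < N)%N by rewrite muln_gt0 N0_gt0 fact_gt0.
have sN s : (0 < s <= r)%N -> (s %| N)%N by move=> sr; rewrite dvdn_mull// dvdn_fact.
split; rewrite ?dvdn_mulr//.
have UN : periodic (fun z => z \in U) N.
  move=> z; apply/idP/idP => /set_mem[s sr xz]; apply/mem_set; exists s => //;
    have := per_periodic x (sN s sr) z; rewrite (mem_set xz).
    by move/esym/set_mem.
  by move/set_mem.
have := density_periodic R UN N_gt0; move: Ue => /[swap] ->.
have N0' : (0 : R) < N%:R by rewrite ltr0n.
rewrite ltr_pdivlMr// => Ue.
have := window_countC (fun z => z \in per x N) 0 N.
move=> /(congr1 (fun n => n%:R : R)); rewrite natrD => NE.
have : (window_count (fun z => z \in U) 0 N)%:R <=
    (window_count (fun z => z \in per x N) 0 N)%:R :> R.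
  rewrite ler_nat; apply: window_count_sub => z; rewrite !inE => -[s sr].
  exact/per_dvdn/sN.
by rewrite -/N in Ue *; move: Ue NE; lra.
Qed.

(** Conditions with coprime periods are independent, by the Chinese remainder
    theorem. *)
(** * Realizing patterns of sifted integers *)

Lemma window_count_coprime (P Q : int -> bool) (M1 M2 : nat) :
  (0 < M1)%N -> (0 < M2)%N -> coprime M1 M2 ->
  periodic P M1 -> periodic Q M2 ->
  window_count (fun z => P z && Q z) 0 (M1 * M2) =
  (window_count P 0 M1 * window_count Q 0 M2)%N.
Proof.
move=> M1_gt0 M2_gt0 co PM QM; apply/eqP; rewrite -(eqr_nat rat); apply/eqP.
rewrite natrM /window_count !natr_sum mulr_suml.
have modE (M z : nat) : (M%:Z %| z%:Z - (z %% M)%N%:Z)%Z.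
  by rewrite -eqz_mod_dvd -modz_nat modz_mod.
transitivity (\sum_(z < M1 * M2) (P (z %% M1)%N%:Z)%:R * (Q (z %% M2)%N%:Z)%:R : rat).
  apply: eq_bigr => z _; rewrite !add0r.
  rewrite (periodic_congr PM (modE M1 z)) (periodic_congr QM (modE M2 z)).
  by case: (P _); case: (Q _); rewrite ?mulr0 ?mul0r ?mulr1.
rewrite (sum_chinese (fun x y => (P x%:Z)%:R * (Q y%:Z)%:R))//.
by apply: eq_bigr => x _; rewrite mulr_sumr add0r; apply: eq_bigr => y _; rewrite add0r.
Qed.

Lemma window_count_residue (N : nat) (r : int) : (0 < N)%N ->
  (0 < window_count (fun z => (N%:Z %| (z - r)%R)%Z) 0 N)%N.
Proof.
move=> N_gt0; rewrite -(window_count_period r (periodic_residue N r)).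
case: N N_gt0 => // N _.
by rewrite /window_count big_ord_recl /= addr0 subrr dvdz0.
Qed.

Lemma harmonic_sum_union (R : realType) (m : nat) (P : int -> bool)
    (Q : 'I_m -> int -> bool) (L : nat) : (forall z, P z -> exists s, Q s z) ->
  harmonic_sum R P L <= \sum_(s < m) harmonic_sum R (Q s) L.
Proof.
move=> PQ; rewrite harmonic_sum_mkcond.
under [leRHS]eq_bigr => s _ do rewrite harmonic_sum_mkcond.
rewrite exchange_big/=; apply: ler_sum => l _.
rewrite -mulr_suml ler_wpM2r ?invr_ge0// -natr_sum ler_nat.
case: (boolP (P _)) => // /PQ[s Qs].
by rewrite (bigD1 s)//= Qs leq_addr.
Qed.

Definition sifted_pattern (A : set nat) (m : nat) (S : nat -> bool) (z : int) :=
  [forall s : 'I_m, S s ==> sifted A (z + s%:Z)].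

Lemma sifted_patternP (A : set nat) (m : nat) (S : nat -> bool) (z : int) :
  reflect (forall s, (s < m)%N -> S s -> sifted A (z + s%:Z))
          (sifted_pattern A m S z).
Proof.
apply: (iffP forallP) => H; last by move=> s; apply/implyP; exact: H.
by move=> s sm Ss; have /implyP -> := H (Ordinal sm).
Qed.

Lemma sifted_pattern_periodic (A : set nat) (m : nat) (S : nat -> bool) (M : nat) :
  periodic (sifted_pattern (divisors_in A M) m S) M.
Proof.
move=> z; apply: eq_forallb => s; congr (_ ==> _).
by rewrite addrAC sifted_periodic.
Qed.

(** By [avoid], only the elements of [A] coprime to [P] can divide [z + s] when
    [z] is [t] modulo [P]. Sieving by these alone stays independent of the residue
    modulo [P], so at a level [M2] coprime to [P] the candidates [z] have density
    at least [k / P]. A candidate fails only if some [z + s] is divisible by an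
    element that the level [M2] misses; by [harmonic_sum_sifted_ge] the
    logarithmic sum over such integers is at most a fraction [d] of the harmonic
    sum, and [m] shifts of it cannot cover all the candidates. *)
Lemma sifted_pattern_exists (R : realType) (A : set nat) (N P m : nat)
    (S : nat -> bool) (r t : int) (k : R) :
  A `<=` posn -> (0 < N)%N -> (0 < P)%N -> coprime N P -> 0 < k ->
  (forall M, (0 < M)%N -> (N %| M)%N -> k * M%:R <= (window_count
     (fun z => (N%:Z %| z - r)%Z && sifted_pattern (divisors_in A M) m S z) 0 M)%:R) ->
  (forall p s z, prime p -> (p %| P)%N -> (s < m)%N -> S s ->
     (P%:Z %| z - t)%Z -> ~~ (p%:Z %| z + s%:Z)%Z) ->
  exists y, [/\ (N%:Z %| y - r)%Z, (P%:Z %| y - t)%Z & sifted_pattern A m S y].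
Proof.
move=> A_posn N_gt0 P_gt0 NP k_gt0 kP avoid.
(* The elements that can still divide a position once [z] is [t] modulo [P]. *)
pose Ao := [set a | A a /\ coprime a P].
have P0 : (0 : R) < P%:R by rewrite ltr0n.
have m0 : (0 : R) < m.+1%:R by rewrite ltr0n.
(* [m * d] is less than the density [k / P] of the candidates. *)
pose d : R := k / (P%:R * m.+1%:R).
have d_gt0 : 0 < d by rewrite divr_gt0// mulr_gt0.
have [M M_gt0 Md] := sieve_limit_adherent Ao d_gt0.
pose M2 := (N * \prod_(b < M.+1 | `[< Ao b >]) b)%N.
have prodP b : Ao b -> (b <= M)%N ->
    (b %| \prod_(b < M.+1 | `[< Ao b >]) b)%N.
  rewrite -ltnS => Ab bM; rewrite (bigD1 (Ordinal bM)) ?dvdn_mulr//=.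
  exact/asboolP.
have M2_gt0 : (0 < M2)%N.
  rewrite muln_gt0 N_gt0; apply: prodn_cond_gt0 => b /asboolP[+ _].
  exact: A_posn.
have NM2 : (N %| M2)%N by exact: dvdn_mulr.
have M2P : coprime M2 P.
  rewrite coprimeMl NP; apply: (big_ind (fun n => coprime n P)) => //.
  - exact: coprime1n.
  - by move=> b c; rewrite coprimeMl => -> ->.
  - by move=> b /asboolP[].
have {}Md : sieve_density R Ao M2 < sieve_limit R Ao + d.
  apply: le_lt_trans Md; apply: sieve_density_le_sub => // b [Ab bM].
  by split => //; rewrite dvdn_mull// prodP// dvdn_leq.
pose E z := (N%:Z %| z - r)%Z && sifted_pattern (divisors_in A M2) m S z.
have EM : periodic E M2.
  apply: periodicI; last exact: sifted_pattern_periodic.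
  exact: periodic_dvdn NM2 (periodic_residue N r).
pose Q := (M2 * P)%N; have Q_gt0 : (0 < Q)%N by rewrite muln_gt0 M2_gt0.
pose G z := E z && (P%:Z %| z - t)%Z.
have GQ : periodic G Q.
  apply: periodicI; first exact: periodic_dvdn (dvdn_mulr _ (dvdnn M2)) EM.
  exact: periodic_dvdn (dvdn_mull _ (dvdnn P)) (periodic_residue P t).
have Gk : k * M2%:R <= (window_count G 0 Q)%:R.
  apply: le_trans (kP _ M2_gt0 NM2) _.
  rewrite /G (window_count_coprime M2_gt0 P_gt0 M2P EM (periodic_residue P t)).
  by rewrite ler_nat leq_pmulr// window_count_residue.
apply: contrapT => noy.
pose bad z := sifted (divisors_in Ao M2) z && ~~ sifted Ao z.
have Gbad z : G z -> exists s : 'I_m, bad (z + s%:Z).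
  move=> /andP[/andP[zN /sifted_patternP zS] zP].
  have [s [sm Ss sA]] : exists s, [/\ (s < m)%N, S s & ~~ sifted A (z + s%:Z)].
    apply: contrapT => nos; apply: noy; exists z; split => //.
    apply/sifted_patternP => s sm Ss; apply: contrapT => /negP sA.
    by apply: nos; exists s.
  exists (Ordinal sm); apply/andP; split.
    apply: sifted_sub (zS _ sm Ss) => b [[Ab _] bM2]; by split.
  case/siftedPn: sA => b Ab bz; apply/siftedPn; exists b => //; split => //.
  rewrite (coprime_has_primes (A_posn _ Ab) P_gt0); apply/hasPn => p.
  rewrite !mem_primes => /and3P[p_prime _ pP]; apply/negP => /and3P[_ _ pb].
  (* A prime common to [b] and [P] would divide the position [z + s]. *)
  have /negP := avoid p s z p_prime pP sm Ss zP; apply.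
  by apply: dvdz_trans bz; rewrite dvdzE.
pose H L := harmonic_sum R predT L.
have badH L : harmonic_sum R bad L <= d * H L + M2%:R.
  have := harmonic_sum_split (R := R) (sifted (divisors_in Ao M2)) (sifted Ao) L.
  have -> : harmonic_sum R (fun z => sifted (divisors_in Ao M2) z && sifted Ao z) L
      = harmonic_sum R (sifted Ao) L.
    apply: eq_bigl => l; rewrite andb_idl//; apply: sifted_sub.
    exact: divisors_in_sub.
  have := harmonic_sum_periodic_le (R := R) L (sifted_periodic Ao M2) M2_gt0.
  have := harmonic_sum_sifted_ge (R := R) Ao L; rewrite -/(sieve_density R Ao M2).
  have := ler_wpM2r (harmonic_sum_ge0 (R := R) predT L) (ltW Md).
  rewrite mulrDl -/(H L) -/bad.
  set a := _ * H L; set b := _ * H L; set c := _ * H L.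
  move: (harmonic_sum R bad L) (harmonic_sum R _ L) (harmonic_sum R _ L).
  by move=> u v w; lra.
(* Shifting the candidates by [m] makes the positions [z - m + s] lie below [z],
   where the weights 1/l are larger. *)
pose Gm z := G (z - m%:Z).
have GmQ : periodic Gm Q by exact: periodic_add GQ.
have GmE : window_count Gm 0 Q = window_count G 0 Q.
  by rewrite (window_count_add G) (window_count_period _ GQ).
have GH L : d * m.+1%:R * H L <= m%:R * (m%:R + (d * H L + M2%:R)) + Q%:R.
  have := harmonic_sum_periodic_ge (R := R) L GmQ Q_gt0; rewrite GmE.
  have : harmonic_sum R Gm L <=
      \sum_(s < m) harmonic_sum R (fun z => bad (z - (m - s)%N%:Z)) L.
    apply: harmonic_sum_union => z /Gbad[s sb]; exists s; move: sb.
    by rewrite -subzn ?(ltnW (ltn_ord s))// opprB addrAC addrA.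
  have : \sum_(s < m) harmonic_sum R (fun z => bad (z - (m - s)%N%:Z)) L <=
      \sum_(s < m) (m%:R + (d * H L + M2%:R)).
    apply: ler_sum => s _; apply: le_trans (harmonic_sum_shift _ _ _) _.
    by rewrite lerD// ler_nat leq_subr.
  rewrite sumr_const card_ord -[_ *+ m]mulr_natl => h1 h2 h3.
  have : d * m.+1%:R * H L <= (window_count G 0 Q)%:R / Q%:R * H L.
    rewrite ler_wpM2r ?harmonic_sum_ge0//.
    have -> : d * m.+1%:R = k * M2%:R / Q%:R.
      rewrite /d /Q natrM; have : (0 : R) < M2%:R by rewrite ltr0n.
      move: (m.+1%:R) (M2%:R) (P%:R) m0 P0 => u v w /lt0r_neq0 u0 /lt0r_neq0 w0.
      by move=> /lt0r_neq0 v0; field; rewrite u0 v0 w0.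
    by rewrite ler_wpM2r.
  by move: h1 h2 h3; rewrite -/(H L); lra.
pose K := m%:R * (m%:R + M2%:R) + Q%:R : R.
have HK L : H L <= K / d.
  rewrite ler_pdivlMr//; have := GH L; rewrite -natr1 /K.
  by move: (H L) => h; nra.
have [L _ /(_ L.+1 (leqnSn L))/=] := near_ln_ge (R := R) (K / d + 1).
have := harmonic_sum_ge_ln (R := R) L; have := HK L; rewrite /H.
by move: (ln _) (harmonic_sum _ _ _) (K / d) => u v w; lra.
Qed.

(** In the class of [r] modulo [N], the residue [t] modulo [P] makes every
    position of [S0] below [m] a multiple of [B]. By the last clause, no prime of [P]
    is wasted: each divides a position of [S0], and so no other position if it is
    larger than [m]. *)
(** * Forcing the zeros of a pattern *)

Definition forces_zeros (B : set nat) (N : nat) (r : int) (S0 : nat -> bool)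
    (m P : nat) (t : int) : Prop :=
  [/\ (0 < P)%N, coprime N P,
    forall s y, (s < m)%N -> S0 s -> (N%:Z %| y - r)%Z -> (P%:Z %| y - t)%Z ->
       ~~ sifted B (y + s%:Z) &
    forall p, prime p -> (p %| P)%N ->
       exists s, [/\ (s < m)%N, S0 s & (p%:Z %| t + s%:Z)%Z]].

Lemma forces_zeros_extend (B : set nat) (N : nat) (r : int) (S0 : nat -> bool)
    (m P : nat) (t : int) (a : nat) (u : int) :
  forces_zeros B N r S0 m P t -> (0 < a)%N -> coprime N a ->
  (P%:Z %| u - t)%Z -> (a%:Z %| u + m%:Z)%Z -> ((1 < a)%N -> S0 m) ->
  (S0 m -> forall y, (N%:Z %| y - r)%Z -> (a%:Z %| y + m%:Z)%Z ->
     ~~ sifted B (y + m%:Z)) ->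
  forces_zeros B N r S0 m.+1 (P * a) u.
Proof.
move=> [P_gt0 NP zP pP] a_gt0 Na Pu au aS Sm; split.
- by rewrite muln_gt0 P_gt0.
- by rewrite coprimeMr NP.
- move=> s y; rewrite ltnS leq_eqVlt => /predU1P[->|sm] Ss yr; rewrite PoszM => yu.
    apply: Sm => //; have -> : y + m%:Z = (y - u) + (u + m%:Z) by ring.
    by rewrite rpredD// (dvdz_trans _ yu)// dvdz_mull.
  apply: zP => //; have -> : y - t = (y - u) + (u - t) by ring.
  by rewrite rpredD// (dvdz_trans _ yu)// dvdz_mulr.
- move=> p p_prime; rewrite Euclid_dvdM// => /orP[pP'|pa].
    have [s [sm Ss pt]] := pP p p_prime pP'.
    exists s; split => //; first exact: ltnW.
    have -> : u + s%:Z = (u - t) + (t + s%:Z) by ring.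
    by rewrite rpredD// (dvdz_trans _ Pu)// dvdzE.
  exists m; split => //.
    by apply: aS; rewrite (leq_trans (prime_gt1 p_prime))// dvdn_leq.
  by rewrite (dvdz_trans _ au)// dvdzE.
Qed.

(** If [e] is in [B] nothing has to be done. If [e] is the cofactor of an infinite
    coprime set, choose in it an [a] coprime to everything used so far and
    require that [a] divide the position: as [e] divides [N], it is coprime to
    [a], so [e * a] divides the position. *)
Lemma forces_zeros_exists (B : set nat) (N m : nat) (S0 : nat -> bool) (r : int) :
  (0 < N)%N ->
  (forall s, (s < m)%N -> S0 s -> exists e,
    [/\ (B `|` coprime_cofactors B) e, (e %| N)%N & (e%:Z %| r + s%:Z)%Z]) ->
  exists P t, forces_zeros B N r S0 m P t.
Proof.
move=> N_gt0; elim: m => [|m IH] eP.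
  exists 1%N, 0; split=> // [|p p_prime]; first exact: coprimen1.
  by rewrite dvdn1 => /eqP p1; rewrite p1 in p_prime.
have [s sm|P [t Pt]] := IH; first exact/eP/ltnW.
have keep : (S0 m -> forall y, (N%:Z %| y - r)%Z -> ~~ sifted B (y + m%:Z)) ->
    exists P t, forces_zeros B N r S0 m.+1 P t.
  move=> Sm; exists (P * 1)%N, t; apply: forces_zeros_extend Pt _ _ _ _ _ _ => //.
  - exact: coprimen1.
  - by rewrite subrr dvdz0.
  - by move=> S0m y yr _; exact: Sm.
have [Sm|nSm] := boolP (S0 m); last by apply: keep => Sm; rewrite Sm in nSm.
have [e [De eN er]] := eP m (ltnSn m) Sm.
have ey y : (N%:Z %| y - r)%Z -> (e%:Z %| y + m%:Z)%Z.
  move=> yr; have -> : y + m%:Z = (y - r) + (r + m%:Z) by ring.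
  by rewrite rpredD// (dvdz_trans _ yr)// dvdzE.
case: De => [Be|[e_gt0 [A [Ap Ainf Aco eA]]]].
  by apply: keep => _ y /ey ye; apply/siftedPn; exists e.
have [P_gt0 _ _ _] := Pt.
have [|a Aa aNP] := coprime_avoid (n := (N * P)%N) Ainf Aco.
  by rewrite muln_gt0 N_gt0.
move: aNP; rewrite coprimeMr => /andP[aN aP].
have Pa : coprimez P%:Z a%:Z by rewrite coprimezE coprime_sym.
pose u := zchinese P a t (- m%:Z).
exists (P * a)%N, u; apply: forces_zeros_extend Pt _ _ _ _ _ _ => //.
- exact: Ap.
- by rewrite coprime_sym.
- by rewrite -eqz_mod_dvd; apply/eqP; exact: zchinese_modl.
- by rewrite -[m%:Z]opprK -eqz_mod_dvd; apply/eqP; exact: zchinese_modr.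
- move=> _ y /ey ye ya; apply/siftedPn; exists (e * a)%N; first by apply: eA; exists a.
  rewrite PoszM Gauss_dvdz ?ye ?ya// coprimezE.
  by apply: coprime_dvdl eN _; rewrite coprime_sym.
Qed.

(** * Frequent patterns *)

Definition occurs (x : biseq) (w : seq bool) (k : int) : bool :=
  [forall s : 'I_(size w), x (k + s%:Z) == nth false w s].

Lemma occursP (x : biseq) (w : seq bool) (k : int) :
  reflect (forall s, (s < size w)%N -> x (k + s%:Z) = nth false w s)
          (occurs x w k).
Proof.
apply: (iffP forallP) => H; last by move=> s; apply/eqP/H.
by move=> s sm; have /eqP := H (Ordinal sm).
Qed.

(** The residue [r] has to serve all levels [M] at once. If each residue failed at
    some level, all would fail at a common multiple of these levels, as [E M]
    shrinks when [M] grows. *)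
Lemma residue_pigeonhole (R : realType) (G : int -> bool)
    (E : nat -> int -> bool) (N : nat) (e : R) :
  (0 < N)%N -> 0 < e -> periodic G N ->
  (forall M, (0 < M)%N -> (N %| M)%N -> periodic (E M) M) ->
  (forall M M' z, (0 < M')%N -> (M %| M')%N -> E M' z -> E M z) ->
  (forall M, (0 < M)%N -> (N %| M)%N ->
     e * M%:R <= (window_count (fun z => G z && E M z) 0 M)%:R) ->
  exists2 r : int, G r & exists2 k : R, 0 < k &
    forall M, (0 < M)%N -> (N %| M)%N ->
     k * M%:R <= (window_count (fun z => (N%:Z %| z - r)%Z && E M z) 0 M)%:R.
Proof.
move=> N_gt0 e_gt0 GN EM Esub eE.
have N0 : (0 : R) < N%:R by rewrite ltr0n.
pose k := e / (2 * N%:R).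
have k_gt0 : 0 < k by rewrite divr_gt0// mulr_gt0.
apply: contrapT => nor.
have /choice[M MP] (r : 'I_N) : exists M, [/\ (0 < M)%N, (N %| M)%N & G r%:Z ->
    (window_count (fun z => (N%:Z %| z - r%:Z)%Z && E M z) 0 M)%:R <= k * M%:R].
  have [Gr|nGr] := boolP (G r%:Z); last by exists N; split.
  apply: contrapT => nM; apply: nor; exists r%:Z => //; exists k => // M M_gt0 NM.
  by rewrite leNgt; apply/negP => /ltW Mk; apply: nM; exists M.
pose Q := (N * \prod_r M r)%N.
have Q_gt0 : (0 < Q)%N.
  by rewrite muln_gt0 N_gt0; apply: prodn_gt0 => r; case: (MP r).
have NQ : (N %| Q)%N by exact: dvdn_mulr.
have MQ r : (M r %| Q)%N by rewrite dvdn_mull// (bigD1 r)//= dvdn_mulr.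
have := eE Q Q_gt0 NQ; apply/negP; rewrite -ltNge.
pose C (r : 'I_N) z := [&& G r%:Z, (N%:Z %| z - r%:Z)%Z & E Q z].
apply: (@le_lt_trans _ _ (\sum_(r < N) (window_count (C r) 0 Q)%:R)).
  rewrite -natr_sum ler_nat; apply: window_count_union => z /andP[Gz Ez].
  have rN : (`|(z %% N)%Z| < N)%N.
    rewrite -ltz_nat gez0_abs ?modz_ge0 ?ltz_pmod ?ltz_nat//.
    by rewrite eqz_nat -lt0n.
  exists (Ordinal rN).
  have zr : (N%:Z %| z - (Ordinal rN)%:Z)%Z.
    rewrite /= gez0_abs; last by rewrite modz_ge0// eqz_nat -lt0n.
    by rewrite -eqz_mod_dvd modz_mod.
  by rewrite /C zr Ez -(periodic_congr GN zr) Gz.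
apply: (@le_lt_trans _ _ (\sum_(r < N) k * Q%:R)).
  apply: ler_sum => r _; have [M_gt0 NM Mk] := MP r.
  have [Gr|nGr] := boolP (G r%:Z); last first.
    have -> : window_count (C r) 0 Q = 0%N.
      by rewrite /window_count big1// => j _; rewrite /C (negbTE nGr).
    by apply: mulr_ge0 => //; exact: ltW.
  pose C' z := (N%:Z %| z - r%:Z)%Z && E (M r) z.
  have C'M : periodic C' (M r).
    apply: periodicI; last exact: EM.
    exact: periodic_dvdn NM (periodic_residue N _).
  apply: (@le_trans _ _ (window_count C' 0 Q)%:R).
    rewrite ler_nat; apply: window_count_sub => z /and3P[_ zr Ez].
    by rewrite /C' zr/=; exact: Esub Ez.
  rewrite (window_count_periodic 0 C'M M_gt0 (MQ r)) ler_wpM2r//.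
  by rewrite ler_pdivrMr ?ltr0n//; exact: Mk.
rewrite sumr_const card_ord -[_ *+ N]mulr_natl mulrA ltr_pM2r ?ltr0n//.
rewrite /k (_ : _ * _ = e / 2); last by field; rewrite lt0r_neq0.
by rewrite gtr_pMr// invf_lt1// ltr1n.
Qed.

Lemma distn_lt_le (m s s' : nat) : (s < m)%N -> (s' < m)%N ->
  (`|s%:Z - s'%:Z| <= m)%N.
Proof. lia. Qed.

(** The counts lose a proportion [d] in two ways, for each position of [w]: residues
    where [eta (star B)] is not determined modulo [N], and integers that survive
    the sieve by [B] at level [N] but not the sieve by [B1] at level [M]. *)
Lemma frequent_pattern (R : realType) (B : set nat) (x : biseq) (w : seq bool)
    (e : R) :
  B `<=` posn -> regular_toeplitz R (eta (star B)) ->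
  (forall i, sifted (B `|` behrend_cofactors R B) i -> x i) ->
  (forall i, x i -> sifted B i) ->
  0 < e ->
  (forall L, (0 < L)%N -> exists k, e * L%:R <= (window_count (occurs x w) k L)%:R) ->
  exists y, forall s, (s < size w)%N ->
    if nth false w s then sifted (B `|` behrend_cofactors R B) (y + s%:Z)
    else ~~ sifted B (y + s%:Z).
Proof.
move=> B_posn reg; set B1 := B `|` _ => B1x xB e_gt0 freq.
set D := B `|` coprime_cofactors B.
have B1_posn : B1 `<=` posn by move=> b [/B_posn|[]].
have D_posn : D `<=` posn by move=> b [/B_posn|[]].
have B1D : B1 `<=` D by move=> b [Bb|/behrend_cofactors_sub//]; left.
have slE : sieve_limit R B1 = sieve_limit R B.
  apply: sieve_limit_setU => c [c_gt0 [A AB cA]]; split => //.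
  by exists A => //; exact: behrend_sieve_limit.
set m := size w.
pose S1 s := nth false w s; pose S0 s := ~~ nth false w s.
(* Two losses of [m * d] each leave a density of at least [e / 2]. *)
pose d : R := e / (4 * m.+1%:R).
have m0 : (0 : R) < m.+1%:R by rewrite ltr0n.
have d_gt0 : 0 < d by rewrite divr_gt0// mulr_gt0.
have md : m%:R * d <= e / 4.
  have -> : e / 4 = m.+1%:R * d by rewrite /d; field; rewrite lt0r_neq0.
  by rewrite ler_wpM2r ?(ltW d_gt0)// ler_nat.
have [M0 M0_gt0 M0d] := sieve_limit_adherent B d_gt0.
(* The factor [m!] makes all primes prime to [N] exceed the length of [w]. *)
have N0_gt0 : (0 < m`! * M0)%N by rewrite muln_gt0 fact_gt0.
have [N [N_gt0 N0N undet]] := regular_toeplitz_period reg N0_gt0 d_gt0.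
set y' := eta (star B) in reg undet.
have N0 : (0 : R) < N%:R by rewrite ltr0n.
have Nd : sieve_density R B N < sieve_limit R B1 + d.
  rewrite slE; apply: le_lt_trans M0d; apply: sieve_density_dvdn => //.
  exact: dvdn_trans (dvdn_mull _ (dvdnn _)) N0N.
pose det k := [forall s : 'I_m, (k + s%:Z) \in per y' N].
pose G z := `[< exists k, [/\ occurs x w k, det k & (N%:Z %| z - k)%Z] >].
have GN : periodic G N.
  move=> z; apply/asboolP/asboolP => -[k [ok dk zk]]; exists k; split => //.
    by move: zk; rewrite addrAC rpredDr.
  by rewrite addrAC rpredDr.
have countG : (e - m%:R * d) * N%:R <= (window_count G 0 N)%:R.
  have [k0 k0e] := freq N N_gt0.
  rewrite mulrBl lerBlDr; apply: le_trans k0e _.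
  rewrite (window_count_split _ det) natrD lerD//.
    rewrite -(window_count_period k0 GN) ler_nat; apply: window_count_sub => z.
    by move=> /andP[oz dz]; apply/asboolP; exists z; rewrite subrr dvdz0.
  apply: (@le_trans _ _ ((\sum_(s < m)
      window_count (fun z => (z + s%:Z)%R \notin per y' N) k0 N)%N%:R : R)).
    rewrite ler_nat; apply: window_count_union => z /andP[_].
    by rewrite negb_forall => /existsP.
  rewrite natr_sum -mulrA mulr_natl -[m in _ *+ m]card_ord -sumr_const.
  apply: ler_sum => s _; rewrite (window_count_add (fun z => z \notin per y' N)).
  rewrite window_count_period//; apply: periodicC.
  exact: per_periodic.
pose E M := sifted_pattern (divisors_in B1 M) m S1.
have countE M : (0 < M)%N -> (N %| M)%N ->
    e / 2 * M%:R <= (window_count (fun z => G z && E M z) 0 M)%:R.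
  move=> M_gt0 NM.
  have : (e - m%:R * d) * M%:R <= (window_count G 0 M)%:R.
    rewrite (window_count_periodic 0 GN N_gt0 NM) ler_wpM2r//.
    by rewrite ler_pdivlMr.
  rewrite (window_count_split G (E M)) natrD.
  pose F z := sifted (divisors_in B N) z && ~~ sifted (divisors_in B1 M) z.
  have FM : periodic F M.
    apply: periodicI; first exact: periodic_dvdn NM (sifted_periodic _ _).
    exact/periodicC/sifted_periodic.
  have cF : (window_count F 0 M)%:R <= d * M%:R.
    have := window_count_split (sifted (divisors_in B N))
      (sifted (divisors_in B1 M)) 0 M.
    have -> : window_count (fun z => sifted (divisors_in B N) z &&
        sifted (divisors_in B1 M) z) 0 M = window_count (sifted (divisors_in B1 M)) 0 M.
      apply: eq_window_count => z; rewrite andb_idl//; apply: sifted_sub.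
      move=> b [Bb bN]; split; [by left|exact: dvdn_trans bN NM].
    move=> /(congr1 (fun n => n%:R : R)); rewrite natrD.
    rewrite !window_count_sifted//; have := sieve_limit_le B1 M_gt0 (R := R).
    have M0' : (0 : R) <= M%:R by [].
    move: Nd M0'; rewrite -/F; move: (sieve_density _ _ _) (sieve_density _ _ _).
    move: (sieve_limit _ _) (M%:R) (window_count F 0 M)%:R => l v c a b.
    move=> h1 h2 h3 h4; have := ler_wpM2r h2 (ltW h1).
    by have := ler_wpM2r h2 h3; nra.
  have : (window_count (fun z => G z && ~~ E M z) 0 M)%:R <= m%:R * d * M%:R.
    apply: (@le_trans _ _ ((\sum_(s < m)
        window_count (fun z => F (z + s%:Z)%R) 0 M)%N%:R : R)).
      rewrite ler_nat; apply: window_count_union => z /andP[/asboolP[k]].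
      move=> [/occursP ok _ zk]; rewrite negb_forall => /existsP[s].
      rewrite negb_imply => /andP[Ss sB1]; exists s; rewrite /F sB1 andbT.
      have zks : (N%:Z %| z + s%:Z - (k + s%:Z))%Z.
        by rewrite (_ : _ - _ = z - k)//; ring.
      rewrite (periodic_congr (sifted_periodic B N) zks).
      apply: sifted_sub (xB _ _); first exact: divisors_in_sub.
      by rewrite ok.
    rewrite natr_sum -mulrA mulr_natl -[m in _ *+ m]card_ord -sumr_const.
    apply: ler_sum => s _; rewrite (window_count_add F).
    by rewrite (window_count_period _ FM).
  have M0' : (0 : R) <= M%:R by [].
  by have := ler_wpM2r M0' md; lra.
have EM M : (0 < M)%N -> (N %| M)%N -> periodic (E M) M.
  by move=> _ _; exact: sifted_pattern_periodic.
have Esub M M' z : (0 < M')%N -> (M %| M')%N -> E M' z -> E M z.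
  move=> M'_gt0 MM' /sifted_patternP sM'; apply/sifted_patternP => s sm Ss.
  by apply: sifted_sub (sM' s sm Ss); exact: divisors_in_dvdn.
have e2_gt0 : 0 < e / 2 by rewrite divr_gt0.
have [r Gr [k k_gt0 kE]] := residue_pigeonhole N_gt0 e2_gt0 GN EM Esub countE.
have /asboolP[k0 [/occursP ok /forallP dk rk]] := Gr.
have [s sm Ss|P [t [P_gt0 NP zeros Pdiv]]] :=
    @forces_zeros_exists B N m S0 r N_gt0.
  have [z zk|e' [De' eN ek]] := sifted_residue_class B_posn N_gt0 (r := k0 + s%:Z).
    have /set_mem/= := dk (Ordinal sm).
    have /dvdzP[q zE] := zk.
    move=> /(_ q); rewrite mulrC -zE addrCA subrr addr0 /y' /star.
    rewrite !eta_primitive_part// => ->.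
    have : ~~ x (k0 + s%:Z) by rewrite ok.
    by apply: contra => sD; apply: B1x; exact: sifted_sub sD.
  exists e'; split => //.
  have -> : r + s%:Z = (r - k0) + (k0 + s%:Z) by ring.
  by rewrite rpredD// (dvdz_trans _ rk)// dvdzE.
have [|y [yr yt /sifted_patternP yS]] :=
    sifted_pattern_exists B1_posn N_gt0 P_gt0 NP k_gt0 kE (t := t).
  move=> p s z p_prime pP sm Ss zt; apply/negP => pzs.
  have [s' [s'm Ss' pts']] := Pdiv p p_prime pP.
  have pd : (p%:Z %| s%:Z - s'%:Z)%Z.
    have -> : s%:Z - s'%:Z = (z + s%:Z) - (z - t) - (t + s'%:Z) by ring.
    apply: rpredB => //; apply: rpredB => //.
    by rewrite (dvdz_trans _ zt)// dvdzE.
  have ss' : s != s' by apply: contraTneq Ss => ->.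
  have pm : (p <= m)%N.
    have : (p <= `|s%:Z - s'%:Z|)%N.
      rewrite dvdn_leq// absz_gt0 subr_eq0 eqz_nat//.
    by move=> /leq_trans; apply; exact: distn_lt_le.
  have pN : (p %| N)%N.
    apply: dvdn_trans N0N; rewrite dvdn_mulr// dvdn_fact// pm prime_gt0//.
  have : (p %| gcdn N P)%N by rewrite dvdn_gcd pN.
  by rewrite (eqP NP) dvdn1 => /eqP p1; rewrite p1 in p_prime.
exists y => s sm; case: ifPn => ws; first exact: yS.
exact: zeros.
Qed.

(** * Cylinders and invariant measures *)

Definition cylinder (w : seq bool) (i : int) : set biseq :=
  [set z | occurs z w i].

Lemma occurs_cons (z : biseq) (b : bool) (w : seq bool) (i : int) :
  occurs z (b :: w) i = (z i == b) && occurs z w (i + 1).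
Proof.
apply/occursP/andP => [zw|[/eqP zi /occursP zw] [|s] //= sw]; last 2 first.
- by rewrite addr0.
- by rewrite -add1n PoszD addrA zw.
split; first by rewrite -[i]addr0 (zw 0%N).
by apply/occursP => s sw; rewrite -addrA -PoszD add1n (zw s.+1).
Qed.

Lemma coordinate_open (i : int) (b : bool) : open [set z : biseq | z i = b].
Proof.
have -> : [set z : biseq | z i = b] = (@proj int (fun=> bool) i) @^-1` [set b].
  by [].
apply: open_comp; last exact: discrete_open.
by move=> z _; exact: proj_continuous.
Qed.

Lemma cylinder_open (w : seq bool) (i : int) : open (cylinder w i).
Proof.
elim: w i => [|b w IH] i.
  rewrite (_ : cylinder _ _ = setT); first exact: openT.
  by apply/seteqP; split => // z _; apply/occursP.
rewrite (_ : cylinder _ _ = [set z | z i = b] `&` cylinder w (i + 1)).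
  by apply: openI; [exact: coordinate_open|exact: IH].
apply/seteqP; split => z; rewrite /cylinder/= occurs_cons.
  by case/andP => /eqP.
by case=> /eqP -> ->.
Qed.

Lemma open_measurable_biseq (A : set biseq) :
  open A -> measurable (A : set borel_biseq).
Proof. by move=> oA; exact: sub_gen_smallest. Qed.

Lemma occurs_shift_by (x : biseq) (w : seq bool) (k i : int) :
  occurs (shift_by k x) w i = occurs x w (i + k).
Proof. by apply: eq_forallb => s; rewrite /shift_by addrAC. Qed.

Lemma orbit_closure_occurs (x z : biseq) (w : seq bool) (i : int) :
  orbit_closure x z -> occurs z w i -> exists k, occurs x w (i + k).
Proof.
move=> xz zw; have [|_ [[k _ <-]]] := xz (cylinder w i).
  by apply: open_nbhs_nbhs; split => //; exact: cylinder_open.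
by rewrite /cylinder/= occurs_shift_by; exists k.
Qed.

(** If each window of [z] occurred in [y], shifts of [y] would agree with [z] on
    larger and larger windows, hence converge to [z]. *)
Lemma not_orbit_closure_occurs (y z : biseq) : ~ orbit_closure y z ->
  exists w i, occurs z w i /\ forall k, ~~ occurs y w k.
Proof.
move=> yz; apply: contrapT => now; apply: yz.
pose w n := mkseq (fun s => z (- n%:Z + s%:Z)) (n + n).+1.
have /choice[k kP] (n : nat) : exists k, occurs y (w n) (- n%:Z + k).
  apply: contrapT => nok; apply: now; exists (w n), (- n%:Z); split.
    by apply/occursP => s; rewrite size_mkseq => sn; rewrite nth_mkseq.
  move=> k; apply/negP => yk; apply: nok; exists (k + n%:Z).
  by rewrite addrC addrK.
have yz n (i : int) : (`|i| <= n)%N -> shift_by (k n) y i = z i.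
  move=> i_n; have /occursP := kP n.
  have [s sE] : exists s : nat, i + n%:Z = s%:Z.
    by exists (absz (i + n%:Z)); rewrite gez0_abs//; lia.
  have sn : (s < (n + n).+1)%N by lia.
  move=> /(_ s); rewrite size_mkseq nth_mkseq// => /(_ sn).
  rewrite /shift_by -sE; congr (y _ = z _); ring.
have ucvg : (fun n => shift_by (k n) y) @ \oo --> (z : biseq).
  apply/cvg_sup => i U [/= _ [[V /= oV <- /= Vz]]] /filterS; apply.
  exists `|i|%N => // n /= i_n; by rewrite /= /proj yz.
apply: (closed_cvg (orbit_closure y) _ _ _ ucvg).
  exact: closed_closure.
by apply: nearW => n; apply: subset_closure; exists (k n).
Qed.

Section InvariantMeasures.
Context {R : realType}.
Implicit Types (mu : probability borel_biseq R) (x y : biseq) (w : seq bool).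

Lemma closed_measurable_biseq (A : set biseq) :
  closed A -> measurable (A : set borel_biseq).
Proof.
move=> cA; rewrite -(setCK A); apply: measurableC.
by apply: open_measurable_biseq; rewrite openC.
Qed.

Lemma orbit_closure_measurable x :
  measurable (orbit_closure x : set borel_biseq).
Proof. by apply: closed_measurable_biseq; exact: closed_closure. Qed.

Lemma cylinder_measurable w (i : int) :
  measurable (cylinder w i : set borel_biseq).
Proof. by apply: open_measurable_biseq; exact: cylinder_open. Qed.

Lemma cylinder_invariant mu (X : set biseq) w (i : int) :
  invariant_measures R X mu -> mu (cylinder w i) = mu (cylinder w 0).
Proof.
move=> [_ inv]; have step j : mu (cylinder w (j + 1)) = mu (cylinder w j).
  rewrite -(inv _ (cylinder_measurable w j)); congr (mu _).
  by apply/seteqP; split => z; rewrite /cylinder/= occurs_shift_by.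
elim/int_ind: i => // n IH; first by rewrite -IH -addn1 PoszD step.
by rewrite -IH -step; congr (mu (cylinder w _)); rewrite -addn1 PoszD; ring.
Qed.

Lemma measure_setI_full mu (X A : set borel_biseq) :
  measurable X -> measurable A -> mu X = 1%E -> mu (A `&` X) = mu A.
Proof.
move=> mX mA X1; have mC : measurable (~` X) by exact: measurableC.
have C0 : mu (A `&` ~` X) = 0%E.
  apply/eqP; rewrite eq_le measure_ge0 andbT.
  apply: (@le_trans _ _ (mu (~` X))).
    by apply: le_measure; rewrite ?inE//; exact: measurableI.
  by rewrite probability_setC// X1 subee.
have AE : A = (A `&` X) `|` (A `&` ~` X) by rewrite -setIUr setUCr setIT.
have dis : (A `&` X) `&` (A `&` ~` X) = set0 by rewrite setIACA setICr setI0.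
have := measureU mu (measurableI _ _ mA mX) (measurableI _ _ mA mC) dis.
by rewrite -AE => ->; rewrite [X in (_ + X)%E]C0 adde0.
Qed.

(** The number of occurrences of [w] at the positions below [L] has integral
    [L * mu (cylinder w 0)], and on the orbit closure it takes the values that
    occur in the windows of [x]. *)
Lemma cylinder_frequency mu x w (L : nat) : (0 < L)%N ->
  invariant_measures R (orbit_closure x) mu ->
  (0 < mu (cylinder w 0))%E ->
  exists k, fine (mu (cylinder w 0)) / 2 * L%:R <=
    (window_count (occurs x w) k L)%:R.
Proof.
move=> L_gt0 muX p_gt0; set X := orbit_closure x in muX.
have mX : measurable (X : set borel_biseq) by exact: orbit_closure_measurable.
have X1 : mu X = 1%E by case: muX.
set p := fine _.
have pE : mu (cylinder w 0) = p%:E.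
  by rewrite fineK// fin_num_measure//; exact: cylinder_measurable.
have p0 : 0 < p by move: p_gt0; rewrite pE lte_fin.
apply: contrapT => nok.
have small k : (window_count (occurs x w) k L)%:R <= p / 2 * L%:R.
  by rewrite leNgt; apply/negP => /ltW pk; apply: nok; exists k.
(* Intersecting with [X] makes the bound on the number of occurrences hold
   everywhere. *)
pose A (j : nat) : set borel_biseq := cylinder w j%:Z `&` X.
have mA j : measurable (A j).
  by apply: measurableI => //; exact: cylinder_measurable.
pose f (j : nat) (z : borel_biseq) : \bar R := (\1_(A j) z)%:E.
have mf j : @measurable_fun _ _ borel_biseq (\bar R) setT (f j).
  by apply/measurable_EFinP; exact: measurable_indic.
have f0 j z : (0 <= f j z)%E by rewrite lee_fin.
have : (\int[mu]_z (\sum_(0 <= j < L) f j z) <=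
    \int[mu]_z (cst (p / 2 * L%:R)%:E z))%E.
  apply: ge0_le_integral => //.
  - by move=> z _; apply: sume_ge0.
  - exact: emeasurable_sum.
  - move=> z _; rewrite sumEFin lee_fin /cst.
    have [Xz|nXz] := pselect (X z); last first.
      rewrite big1 ?mulr_ge0 ?divr_ge0 ?(ltW p0)// => j _.
      by rewrite indicE memNset// => -[].
    pose u := mkseq (fun s => z s%:Z) (L + size w).
    have zu : occurs z u 0.
      by apply/occursP => s; rewrite size_mkseq add0r => su; rewrite nth_mkseq.
    have [k /occursP xu] := orbit_closure_occurs Xz zu.
    apply: le_trans (small k).
    rewrite /window_count natr_sum.
    rewrite -(big_mkord xpredT (fun j => (occurs x w (k + j%:Z))%:R : R)).
    apply: ler_sum_nat => j /andP[_ jL].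
    rewrite indicE ler_nat.
    case: (boolP (z \in A j)) => // /set_mem[/occursP zw _].
    rewrite lt0b; apply/occursP => s sw.
    have jsu : (j + s < L + size w)%N by rewrite -addnS leq_add// ltnW.
    have := xu (j + s)%N; rewrite size_mkseq nth_mkseq// => /(_ jsu).
    by rewrite add0r PoszD addrA => ->; rewrite -zw.
rewrite ge0_integral_sum// integral_cst//= probability_setT mule1.
rewrite (eq_bigr (fun=> p%:E)); last first.
  move=> j _; rewrite integral_indic// setIT.
  apply: etrans (measure_setI_full mX (cylinder_measurable w j%:Z) X1) _.
  by rewrite -pE; exact: cylinder_invariant muX.
rewrite sumEFin lee_fin big_const_seq count_predT size_iota subn0.
rewrite iter_addr addr0 -[_ *+ L]mulr_natr ler_pM2r ?ltr0n//.
by rewrite leNgt gtr_pMr// invf_lt1// ltr1n.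
Qed.

(** The complement of the orbit closure of [y] is covered by the countably many
    cylinders of patterns that do not occur in [y], and none of them is charged. *)
Lemma invariant_measures_between (B : set nat) x y :
  B `<=` posn -> regular_toeplitz R (eta (star B)) ->
  (forall z : biseq, z = x \/ z = y -> forall i,
    (sifted (B `|` behrend_cofactors R B) i -> z i) /\ (z i -> sifted B i)) ->
  invariant_measures R (orbit_closure x) `<=`
  invariant_measures R (orbit_closure y).
Proof.
move=> B_posn reg xy mu muX; split; last by case: muX.
have null w : (forall k, ~~ occurs y w k) -> mu (cylinder w 0) = 0%E.
  move=> now; apply/eqP; rewrite -measure_le0 leNgt; apply/negP => p_gt0.
  set p := fine (mu (cylinder w 0)) / 2.
  have p0 : 0 < p.
    rewrite divr_gt0// fine_gt0// p_gt0/= ltey_eq.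
    by rewrite fin_num_measure//; exact: cylinder_measurable.
  have xB i := xy x (or_introl erefl) i.
  have [k kP] := frequent_pattern B_posn reg (fun i => (xB i).1)
    (fun i => (xB i).2) p0 (fun L L_gt0 => cylinder_frequency L_gt0 muX p_gt0).
  have /negP := now k; apply; apply/occursP => s sw; have := kP s sw.
  have [yB By] := xy y (or_intror erefl) (k + s%:Z).
  case: (nth false w s); first exact: yB.
  by move=> nB; apply/negbTE; apply: contra nB; exact: By.
have mY : measurable (orbit_closure y : set borel_biseq).
  exact: orbit_closure_measurable.
suff C0 : mu (~` orbit_closure y) = 0%E.
  have := probability_setC mu (measurableC mY); rewrite setCK => ->.
  by rewrite C0 sube0.
apply: measure_negligible; first exact: measurableC.
pose F (n : nat) : set borel_biseq :=
  if unpickle n is Some (w, i) then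
    if `[< forall k, ~~ occurs y w k >] then cylinder w i else set0
  else set0.
apply: (@negligibleS _ _ _ mu (\bigcup_n F n)).
  move=> z /not_orbit_closure_occurs[w [i [zw now]]].
  exists (pickle (w, i)) => //; rewrite /F pickleK.
  by case: asboolP => // nnow; exfalso; exact: nnow.
apply: negligible_bigcup => n; rewrite /F.
case: unpickle => [[w i]|]; last exact: negligible_set0.
case: asboolP => [now|_]; last exact: negligible_set0.
apply/negligibleP; first exact: cylinder_measurable.
by apply: etrans (cylinder_invariant w i muX) _; exact: null.
Qed.

End InvariantMeasures.

Theorem theoremC (R : realType) (B : set nat) :
  B `<=` posn ->
  regular_toeplitz R (eta (star B)) ->
  invariant_measures R (orbit_closure (eta B)) =
  invariant_measures R (orbit_closure (eta (tautification R B))).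
Proof.
move=> B_posn reg.
have B1_posn : B `|` behrend_cofactors R B `<=` posn by move=> b [/B_posn|[]].
have etaE i : eta (tautification R B) i = sifted (B `|` behrend_cofactors R B) i.
  exact: eta_primitive_part.
have subB i : sifted (B `|` behrend_cofactors R B) i -> sifted B i.
  by apply: sifted_sub => b; left.
by apply/seteqP; split; apply: invariant_measures_between reg _ => // z [] ->;
  move=> i; rewrite ?etaE ?eta_sifted; split => //; exact: subB.
Qed.
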